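(* Let $\{(X_n,d_n)\}_{n\in\mathbb{Z}}$ be compact metric spaces, fix constants $D,\tau\in\mathbb{N}$, $\delta>0$, $\rho,\beta\in(0,1)$, $H,V>0$, and let $\mathcal{F}$ be the set of sequences $(\mathbf{T},\boldsymbol{\varphi})=((T_n,\varphi_n))_{n\in\mathbb{Z}}$ satisfying (A1)–(A4) of the context with these constants, with the $[0,\infty]$-valued metric $$d_{\mathcal{F}}((\mathbf{T},\boldsymbol{\varphi}),(\mathbf{T}',\boldsymbol{\varphi}'))=\sum_{n\in\mathbb{Z}}2^{-|n|}\Big(\sup_{x\in X_n}d_{n+1}(T_n(x),T_n'(x))+\|\varphi_n-\varphi_n'\|_\infty\Big).$$ Let $Q$ be sufficiently large (depending only on the constants above), let $\Lambda_n=\Lambda_n(Q)$, and for $(\mathbf{T},\boldsymbol{\varphi})\in\mathcal{F}$ let $(\lambda_n,m_n,h_n)_{n\in\mathbb{Z}}$ be the associated real numbers, probability measures, and functions defined in the context. Then the map $(\mathbf{T},\boldsymbol{\varphi})\mapsto(\lambda_0,m_0,h_0)$ is locally Hölder continuous with respect to $d_{\mathcal{F}}$, in the following sense: (a) the real number $\lambda_0$ depends locally Hölder continuously on $(\mathbf{T},\boldsymbol{\varphi})$; (b) for every $f\in\Lambda_0$, the integral $\int_{X_0}f\,dm_0$ depends locally Hölder continuously on $(\mathbf{T},\boldsymbol{\varphi})$; (c) the function $h_0\in\Lambda_0\subset C(X_0)$ depends locally Hölder continuously on $(\mathbf{T},\boldsymbol{\varphi})$ with respect to the uniform metric on $C(X_0)$.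 By shifting the sequence, the analogous local Hölder continuity holds for $(\lambda_n,m_n,h_n)$ for every $n\in\mathbb{Z}$.
   Context: A map between (possibly $[0,\infty]$-valued) metric spaces is locally Hölder continuous if every point of the domain has a neighbourhood on which the map is Hölder continuous for some exponent and constant. For maps $T_n\colon X_n\to X_{n+1}$ and continuous $\varphi_n\colon X_n\to\mathbb{R}$, $n\in\mathbb{Z}$, write $\mathbf{T}_n^k=T_{n+k-1}\circ\cdots\circ T_n$; $B(x,\delta)$ is the closed ball of radius $\delta$. The conditions, with the constants $D,\delta,\rho,\tau,H,\beta,V$ fixed, are, for all $n\in\mathbb{Z}$: (A1) Each $(X_n,d_n)$ is compact, each $T_n$ is continuous, and $1\le\#T_n^{-1}(x)\le D$ for every $x\in X_{n+1}$. (A2) For all $x,x'\in X_n$ with $d_n(x,x')\le\delta$, $d_n(x,x')\le\rho\,d_{n+1}(T_n(x),T_n(x'))$; and for any $x\in X_n$, $T_n(B(x,\delta))\supset B(T_nx,\delta)$. (A3) For every $x\in X_n$, $\mathbf{T}_n^\tau(B(x,\delta))=X_{n+\tau}$. (A4) For all $x,x'\in X_n$ with $d_n(x,x')\le\delta$, $|\varphi_n(x)-\varphi_n(x')|\le Hd_n(x,x')^\beta$; and $\|\varphi_n\|_\infty\le V$. Operators: $(L_nf)(x)=\sum_{y\in T_n^{-1}(x)}e^{\varphi_n(y)}f(y)$, $L_n\colon C(X_n)\to C(X_{n+1})$; $\mathbf{L}_n^k=L_{n+k-1}\circ\cdots\circ L_n$. $M(X_n)$ is the set of positive (nonzero) finite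 Borel measures, $\langle f,m\rangle=\int f\,dm$, and $(\mathbf{L}_n^k)^*\colon M(X_{n+k})\to M(X_n)$ is defined by $\langle f,(\mathbf{L}_n^k)^*m\rangle=\langle\mathbf{L}_n^kf,m\rangle$. $\mathbf{1}$ is the constant function $1$. Cones: $C_n^+=\{f\in C(X_n):f\ge0,f\not\equiv0\}$ and $\Lambda_n(Q)=\{f\in C_n^+:f(x)\le e^{Qd_n(x,x')^\beta}f(x')\text{ whenever }d_n(x,x')\le\delta\}$. Definition of $\lambda_n,m_n,h_n$: for $Q$ sufficiently large (depending only on the fixed constants), the following limits exist for every $(\mathbf{T},\boldsymbol{\varphi})\in\mathcal{F}$ and $n\in\mathbb{Z}$, and do not depend on the choice of $\sigma_\ell\in M(X_\ell)$ and $f_\ell\in\Lambda_\ell$: $$\lambda_n=\lim_{k\to\infty}\frac{\langle\mathbf{L}_n^k\mathbf{1},\sigma_{n+k}\rangle}{\langle\mathbf{L}_{n+1}^{k-1}\mathbf{1},\sigma_{n+k}\rangle},\quad m_n=\lim_{k\to\infty}\frac{(\mathbf{L}_n^k)^*\sigma_{n+k}}{\langle\mathbf{1},(\mathbf{L}_n^k)^*\sigma_{n+k}\rangle}\ (\text{weak*}),\quad h_n=\lim_{k\to\infty}\frac{\mathbf{L}_{n-k}^kf_{n-k}}{\big(\prod_{j=n-k}^{n-1}\lambda_j\big)\langle f_{n-k},m_{n-k}\rangle}\ (\text{uniformly}).$$ *)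

(* Defs.v *)
From HB Require Import structures.
From mathcomp Require Import all_boot all_order all_algebra.
From mathcomp Require Import all_classical all_reals all_analysis.

Set Implicit Arguments.
Unset Strict Implicit.
Unset Printing Implicit Defensive.

Import Order.TTheory GRing.Theory Num.Theory.
Import numFieldNormedType.Exports.

Local Open Scope classical_set_scope.
Local Open Scope ring_scope.

(* Nonempty metric spaces. The chosen point carries no content: it is only
   required by the library to put a sigma-algebra on the type. *)
#[short(type="pmetricType")]
HB.structure Definition PMetric (K : numDomainType) :=
  {M of Metric K M & Pointed M}.

(* The library's [ball] is the open ball and its [closed_ball] is the closure
   of the open ball, which can be smaller than [cball]. *)
Definition cball (R : realType) (X : metricType R) (x : X) (r : R) : set X :=
  [set y | mdist x y <= r].

Definition sup_norm (R : realType) (X : Type) (f : X -> R) : \bar R :=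
  ereal_sup (range (fun x => `|f x|%:E)).

Definition sup_dist (R : realType) (X : Type) (Y : metricType R)
    (f g : X -> Y) : \bar R :=
  ereal_sup (range (fun x => (mdist (f x) (g x))%:E)).

Notation borel X := (g_sigma_algebraType (@open X)).

(* Local Hoelder continuity, on the subset S of U, of a map between spaces with
   [0,+oo]-valued distances. *)
Definition locally_holder (R : realType) (U W : Type) (S : set U)
    (dU : U -> U -> \bar R) (dW : W -> W -> \bar R) (F : U -> W) : Prop :=
  forall u, S u ->
  exists r a C : R, [/\ 0 < r, 0 < a <= 1, 0 <= C &
    forall v w, S v -> S w -> (dU u v < r%:E)%E -> (dU u w < r%:E)%E ->
      (dW (F v) (F w) <= C%:E * (dU v w) `^ a)%E].

Definition real_dist (R : realType) (x y : R) : \bar R := `|x - y|%:E.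

Definition unif_dist (R : realType) (X : Type) (f g : X -> R) : \bar R :=
  sup_norm (fun x => f x - g x).

(* The index n + k, in a form for which [fwd n k.+1] is convertible to
   [fwd n k + 1], so that the k-fold compositions below need no casts. *)
Definition fwd (n : int) (k : nat) : int := iter k (fun i : int => i + 1) n.

Lemma fwdE (n : int) (k : nat) : fwd n k = n + k%:Z.
Proof.
elim: k => [|k IH]; first by rewrite /fwd /= addr0.
by rewrite -addn1 PoszD addrA -IH addn1.
Qed.

(* A sequence (T, phi) = ((T_n, phi_n))_{n in Z}. *)
Record system (R : realType) (X : int -> pmetricType R) := System {
  smap : forall n : int, X n -> X (n + 1) ;
  spot : forall n : int, X n -> R }.

Arguments smap {R X} s n x.
Arguments spot {R X} s n x.

Section system.
Variables (R : realType) (X : int -> pmetricType R).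
Implicit Type P : system X.

Fixpoint smap_iter P (n : int) (k : nat) : X n -> X (fwd n k) :=
  match k return X n -> X (fwd n k) with
  | 0%N => fun x => x
  | k'.+1 => fun x => smap P (fwd n k') (smap_iter P k' x)
  end.

Arguments smap_iter P n k x : clear implicits.

(* Membership in the family F with these constants; the compactness of the X_n,
   which does not involve P, is not part of it. *)
Record admissible (D tau : nat) (delta rho beta H V : R) P : Prop := Admissible {
  adm_continuous : forall n : int, continuous (smap P n) ;
  adm_fibre : forall (n : int) (x : X (n + 1)),
    smap P n @^-1` [set x] !=set0 /\
    (smap P n @^-1` [set x] #<= `I_D)%card ;
  adm_expand : forall (n : int) (x x' : X n), mdist x x' <= delta ->
    mdist x x' <= rho * mdist (smap P n x) (smap P n x') ;
  adm_cover : forall (n : int) (x : X n),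
    cball (smap P n x) delta `<=` smap P n @` cball x delta ;
  adm_exact : forall (n : int) (x : X n),
    smap_iter P n tau @` cball x delta = [set: X (fwd n tau)] ;
  adm_pot_continuous : forall n : int, continuous (spot P n) ;
  adm_pot_holder : forall (n : int) (x x' : X n), mdist x x' <= delta ->
    `|spot P n x - spot P n x'| <= H * mdist x x' `^ beta ;
  adm_pot_bound : forall n : int, (sup_norm (spot P n) <= V%:E)%E }.

Definition system_dist P P' : \bar R :=
  (\esum_(n in [set: int]) (2 ^- `|n|%N)%:E *
     (sup_dist (smap P n) (smap P' n) +
      unif_dist (spot P n) (spot P' n)))%E.

Definition transfer P (n : int) (g : X n -> R) : X (n + 1) -> R :=
  fun x => \sum_(y \in smap P n @^-1` [set x]) expR (spot P n y) * g y.

Fixpoint transfer_iter P (n : int) (k : nat) (g : X n -> R) :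
    X (fwd n k) -> R :=
  match k return X (fwd n k) -> R with
  | 0%N => g
  | k'.+1 => transfer (n := fwd n k') P (transfer_iter P (n := n) (k := k') g)
  end.

Arguments transfer P n g x : clear implicits.
Arguments transfer_iter P n k g x : clear implicits.

Definition pairing (n : int) (g : X n -> R)
    (mu : {measure set (borel (X n)) -> \bar R}) : R :=
  (\int[mu]_x g x)%R.

(* (L_n^k)^* mu, as the functional on C(X_n) by which it is defined. *)
Definition transfer_dual P (n : int) (k : nat)
    (mu : {measure set (borel (X (fwd n k))) -> \bar R}) (g : X n -> R) : R :=
  pairing (transfer_iter P n k g) mu.

Definition cone (delta beta Q : R) (n : int) : set (X n -> R) :=
  [set g : X n -> R | [/\ continuous g, forall x, 0 <= g x, exists x, g x != 0 &
    forall x x', mdist x x' <= delta ->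
      g x <= expR (Q * mdist x x' `^ beta) * g x']].

Arguments transfer_dual P n k mu g : clear implicits.

Section limits.
Variables (P : system X)
  (sigma : forall l : int, {finite_measure set (borel (X l)) -> \bar R})
  (f : forall l : int, X l -> R)
  (lam : int -> R) (m : forall l : int, probability (borel (X l)) R)
  (h : forall l : int, X l -> R).
Arguments f : clear implicits.
Arguments h : clear implicits.

(* The k-th term is the quotient for k + 1; the indices of the two sigma's are
   both equal to n + k + 1. *)
Definition lam_limit (n : int) : Prop :=
  (fun k : nat =>
     pairing (transfer_iter P n k.+1 (cst 1)) (sigma (fwd n k.+1)) /
     pairing (transfer_iter P (n + 1) k (cst 1)) (sigma (fwd (n + 1) k)))
  @ \oo --> lam n.

Definition m_limit (n : int) : Prop :=
  forall g : X n -> R, continuous g ->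
  (fun k : nat =>
     transfer_dual P n k (sigma (fwd n k)) g /
     transfer_dual P n k (sigma (fwd n k)) (cst 1))
  @ \oo --> pairing g (m n).

(* The k-th function lives on X_{(n-k)+k}, and the index
   [fwd (n - k%:Z) k] is equal to n. *)
Definition h_limit (n : int) : Prop :=
  (fun k : nat =>
     unif_dist
       (fun x => transfer_iter P (n - k%:Z) k (f (n - k%:Z)) x /
          ((\prod_(i < k) lam (n - k%:Z + i%:Z)) *
             pairing (f (n - k%:Z)) (m (n - k%:Z))))
       (h (fwd (n - k%:Z) k)))
  @ \oo --> 0%E.

(* (lam_n, m_n, h_n)_n are the limits associated with P, computed with the
   auxiliary measures sigma_l in M(X_l) and functions f_l in Lambda_l(Q). *)
Record associated (delta beta Q : R) : Prop := Associated {
  assoc_sigma : forall l : int, (0 < sigma l setT)%E ;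
  assoc_f : forall l : int, cone delta beta Q (f l) ;
  assoc_lam : forall n : int, lam_limit n ;
  assoc_m : forall n : int, m_limit n ;
  assoc_h : forall n : int, h_limit n }.
End limits.

End system.

Arguments smap_iter {R X} P n k x.
Arguments transfer {R X} P n g x.
Arguments transfer_iter {R X} P n k g x.
Arguments transfer_dual {R X} P n k mu g.

(* Main.v *)
Require Import Defs.
From HB Require Import structures.
From mathcomp Require Import all_boot all_order all_algebra.
From mathcomp Require Import all_classical all_reals all_analysis.
From mathcomp Require Import ring lra zify.

Set Implicit Arguments.
Unset Strict Implicit.
Unset Printing Implicit Defensive.

Import Order.TTheory GRing.Theory Num.Theory.
Import numFieldNormedType.Exports.

Local Open Scope classical_set_scope.
Local Open Scope ring_scope.

(** The transfer operators of a sequence forget their argument exponentially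
    fast, at a rate that depends only on the constants of the family, so the
    eigendata at time [n] are determined, up to an error [theta ^ J], by the
    [k], about [J * (tau + 1)], operators before and after time [n]. Two
    sequences at distance [d] have operators that differ on this window by
    factors close to [1], as long as [2 ^ k * d] is small. Balancing the two
    errors, with [k] of the order of [- log d], gives a power of [d].

    Loss of memory. One operator sends the cone of exponent [Q] into the one of
    exponent [rho ^ beta * Q + gain], smaller than [Q] once [Q] is large
    (transfer_regular). After [tau + 1] steps the values of a regular function
    are moreover comparable to each other (transfer_iter_harnack), so a fixed
    proportion of a function of the cone can be subtracted from any other one
    of the same size (regular_sub). Hence if [a * v <= u <= b * v] in the order
    of the cone, each block of [tau + 1] steps shrinks [b - a] by a fixed
    factor (pinched_step), and the images of two regular functions become
    proportional (transfer_iter_memory).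

    Perturbation. When two maps are uniformly close, the covering property
    matches their fibres injectively, and the regularity of [g] bounds the
    ratio of the two images of [g] (transfer_compare). The bound is
    multiplicative, so it is stable under the positive operators that follow
    (transfer_iter_perturb).

    Eigendata. The limits that define them give [< L_n g, m (n + 1) > = lam n *
    < g, m n >] (pairing_transfer), [L_n (h n) = lam n * h (n + 1)]
    (h_transfer) and [< h n, m n > = 1] (h_pairing). Then [< g, m n >] is the
    ratio of [< L^k g, m (n + k) >] and [< L^k 1, m (n + k) >]; [lam n] is [<
    L_n 1, m (n + 1) >]; and [h n] is [L^k (h (n - k))] normalised, so nearly
    proportional to [L^k 1]. Loss of memory and perturbation compare each of
    these for two sequences, up to a factor [expR total_error] (pairing_window,
    lam_window, h_window), and holder_of_scales converts the resulting bounds,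
    one for each size of window, into a power of [d]. *)

(** * Finitely supported sums *)

Section fibre_sums.
Variables (R : realType).

Lemma ler_fsum (I : choiceType) (A : set I) (u v : I -> R) :
  finite_set A -> (forall i, A i -> u i <= v i) ->
  \sum_(i \in A) u i <= \sum_(i \in A) v i.
Proof.
move=> fA uv; rewrite !fsbig_finite//= big_seq [leRHS]big_seq.
by apply: ler_sum => i; rewrite in_fset_set// inE => /uv.
Qed.

Lemma ler_fsum_subset (I : choiceType) (A B : set I) (v : I -> R) :
  finite_set B -> A `<=` B -> (forall i, B i -> 0 <= v i) ->
  \sum_(i \in A) v i <= \sum_(i \in B) v i.
Proof.
move=> fB AB v0; have fA := sub_finite_set AB fB.
rewrite [leRHS](fsbigID A)//= setIidr//= lerDl.
by apply: fsumr_ge0 => i [] /v0.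
Qed.

Lemma ler_fsum_inj (I J : choiceType) (A : set I) (B : set J) (j : I -> J)
    (u : I -> R) (v : J -> R) (E : R) :
  finite_set A -> finite_set B -> set_inj A j -> 0 <= E ->
  (forall y, B y -> 0 <= v y) ->
  (forall x, A x -> B (j x) /\ u x <= E * v (j x)) ->
  \sum_(x \in A) u x <= E * \sum_(y \in B) v y.
Proof.
move=> fA fB ji E0 v0 uv.
apply: le_trans (_ : _ <= \sum_(x \in A) E * v (j x)) _.
  by apply: ler_fsum => // x /uv[].
rewrite -mulr_fsumr; apply: ler_wpM2l => //.
rewrite -(@reindex_fsbig _ _ _ _ _ j A (j @` A) v); last first.
  by split=> // x Ax; exists x.
by apply: ler_fsum_subset => // y [x /uv[Bjx _] <-].
Qed.

Lemma ler_fsum_card (I : choiceType) (A : set I) (u : I -> R) (D : nat)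
    (E : R) :
  (A #<= `I_D)%card -> 0 <= E -> (forall x, A x -> u x <= E) ->
  \sum_(x \in A) u x <= D%:R * E.
Proof.
move=> AD E0 uE; have fA : finite_set A := card_le_finite AD (finite_II D).
rewrite fsbig_finite//= big_seq.
apply: (le_trans (ler_sum _ (G := fun=> E) _)).
  by move=> i; rewrite in_fset_set// inE => /uE.
rewrite -big_seq big_const_seq iter_addr_0 count_predT -[leLHS]mulr_natl.
by rewrite ler_wpM2r// ler_nat geq_card_fset_set.
Qed.

End fibre_sums.

Lemma expR_sub1_le (R : realType) (t : R) : expR t - 1 <= t * expR t.
Proof.
have := expR_ge1Dx (- t); rewrite -(ler_pM2r (expR_gt0 t)) -expRD addNr expR0.
by rewrite mulrDl mul1r mulNr; lra.
Qed.

(** * Regular functions *)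

Section regular.
Variables (R : realType) (delta beta : R).

(** The cone enlarged by [0]: the differences [u - a * v] formed below are
    compared with it, and they may vanish. *)
Definition regular (Q : R) (M : metricType R) (g : M -> R) : Prop :=
  (forall x, 0 <= g x) /\
  forall x x', mdist x x' <= delta ->
    g x <= expR (Q * mdist x x' `^ beta) * g x'.

Lemma regular_cone (X : int -> pmetricType R) n Q (g : X n -> R) :
  cone delta beta Q g -> regular Q g.
Proof. by case=> _ g0 _ gQ; split. Qed.

Lemma regular_le Q Q' (M : metricType R) (g : M -> R) :
  Q <= Q' -> regular Q g -> regular Q' g.
Proof.
move=> QQ' [g0 gQ]; split=> // x x' /gQ /le_trans; apply.
by rewrite ler_wpM2r// ler_expR ler_wpM2r// powR_ge0.
Qed.

Lemma regularZ Q (M : metricType R) (c : R) (g : M -> R) :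
  0 <= c -> regular Q g -> regular Q (fun x => c * g x).
Proof.
move=> c0 [g0 gQ]; split=> [x|x x' /gQ h]; first by rewrite mulr_ge0.
by rewrite mulrCA ler_wpM2l.
Qed.

Lemma regular_cst1 Q (M : metricType R) : 0 <= Q -> regular Q (cst 1 : M -> R).
Proof.
move=> Q0; split=> [x|x x' _]; first exact: ler01.
by rewrite /= mulr1 -expR0 ler_expR mulr_ge0// powR_ge0.
Qed.

Hypotheses (delta_gt0 : 0 < delta) (beta_gt0 : 0 < beta).

(** At small distances the inequality bounds the oscillation of [g] around [x]
    by a multiple of [g x]. *)
Lemma regular_continuous Q (M : metricType R) (g : M -> R) :
  0 < Q -> regular Q g -> continuous g.
Proof.
move=> Q0 [g0 gQ] x; apply/cvgrPdist_lt => e e0.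
(* [(expR t - 1) * expR t <= c ^+ 2 * t] for [t <= 1], and this [t] makes
   [c ^+ 2 * t * g x] less than [e]. *)
pose c := expR (1 : R); pose t := e / (c ^+ 2 * (g x + 1) + e).
have c0 : 0 < c := expR_gt0 _.
have gx1 : 0 < g x + 1 by rewrite ltr_wpDl.
have den0 : 0 < c ^+ 2 * (g x + 1) + e by rewrite addr_gt0// mulr_gt0// exprn_gt0.
have t0 : 0 < t by rewrite divr_gt0.
have t1 : t <= 1 by rewrite ler_pdivrMr// mul1r lerDr mulr_ge0 ?ltW// exprn_gt0.
have ct : c ^+ 2 * t * g x < e.
  rewrite /t mulrA mulrAC ltr_pdivrMr// mulrAC [ltRHS]mulrC ltr_pM2r//.
  by rewrite mulrDr; have := exprn_gt0 2 c0; lra.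
clearbody t.
pose r := Num.min delta ((t / Q) `^ beta^-1).
have r0 : 0 < r by rewrite lt_min delta_gt0 powR_gt0// divr_gt0.
apply/nbhs_ballP; exists r => //= y; rewrite ballEmdist /= => xy.
have d1 : mdist x y <= delta by apply: (le_trans (ltW xy)); rewrite ge_min lexx.
have d2 : Q * mdist x y `^ beta <= t.
  rewrite mulrC -ler_pdivlMr//.
  have -> : t / Q = ((t / Q) `^ beta^-1) `^ beta.
    by rewrite -powRrM mulVf ?gt_eqF// powRr1// divr_ge0// ltW.
  apply: ge0_ler_powR; rewrite ?nnegrE ?mdist_ge0 ?powR_ge0 ?ltW//.
  by apply: (lt_le_trans xy); rewrite ge_min lexx orbT.
have et1 : 1 <= expR t by rewrite -expR0 ler_expR ltW.
have etc : expR t <= c by rewrite ler_expR.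
have h1 : g x <= expR t * g y.
  by apply: (le_trans (gQ _ _ d1)); rewrite ler_wpM2r// ler_expR.
have h2 : g y <= expR t * g x.
  rewrite metric_sym in d1 d2.
  by apply: (le_trans (gQ _ _ d1)); rewrite ler_wpM2r// ler_expR.
have h3 : expR t - 1 <= t * c.
  by apply: (le_trans (expR_sub1_le t)); rewrite ler_wpM2l// ltW.
have h4 : (expR t - 1) * g x <= t * c * g x by rewrite ler_wpM2r.
have h5 : (expR t - 1) * g y <= t * c * g y by rewrite ler_wpM2r.
have h6 : t * c * g y <= t * c * (c * g x).
  rewrite ler_wpM2l ?mulr_ge0 ?(ltW t0) ?(ltW c0)//.
  by apply: (le_trans h2); rewrite ler_wpM2r.
have c1 : 1 <= c by apply: le_trans etc.
have h7 : t * c * g x <= t * c * (c * g x).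
  rewrite ler_wpM2l ?mulr_ge0 ?(ltW t0) ?(ltW c0)//.
  by rewrite ler_peMl.
have h8 : t * c * (c * g x) = c ^+ 2 * t * g x by ring.
by rewrite ltr_norml; apply/andP; split; lra.
Qed.

End regular.

Lemma fwdSl n k : fwd (n + 1) k = fwd n k.+1.
Proof. by rewrite !fwdE -addrA -[k.+1]add1n. Qed.

Lemma absz_fwd n k : `|fwd n k - n|%N = k.
Proof. by rewrite fwdE addrAC subrr add0r. Qed.

Lemma absz_fwd_back n i k : (i <= k)%N -> (`|fwd n i - fwd n k| <= k)%N.
Proof. by move=> ik; rewrite !fwdE; lia. Qed.

(** * Transfer operators *)

Section transfer.
Variables (R : realType) (X : int -> pmetricType R) (D tau : nat).
Variables (delta rho beta H V : R).
Hypotheses (delta_gt0 : 0 < delta) (rho01 : 0 < rho < 1)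
  (beta01 : 0 < beta < 1) (H_gt0 : 0 < H).

Local Notation adm := (admissible D tau delta rho beta H V).
Local Notation reg := (regular delta beta).

Lemma adm_fibre_finite P n (x : X (n + 1)) :
  adm P -> finite_set (smap P n @^-1` [set x]).
Proof. by move=> /adm_fibre /(_ n x)[_ /card_le_finite]; apply. Qed.

Lemma adm_spot_bound P n (y : X n) : adm P -> `|spot P n y| <= V.
Proof.
move=> /adm_pot_bound /(_ n) hV; rewrite -lee_fin; apply: le_trans hV.
by apply: ereal_sup_ubound; exists y.
Qed.

Lemma transfer_lin P n (a b : R) (u v : X n -> R) : adm P ->
  transfer P n (fun x => a * u x + b * v x) =
  (fun x => a * transfer P n u x + b * transfer P n v x).
Proof.
move=> aP; apply/funext => x; rewrite /transfer !mulr_fsumr -fsbig_split/=.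
  by apply: eq_fsbigr => y _; ring.
exact: adm_fibre_finite.
Qed.

Lemma transfer_ge0 P n (g : X n -> R) : (forall x, 0 <= g x) ->
  forall x, 0 <= transfer P n g x.
Proof.
by move=> g0 x; apply: fsumr_ge0 => y _; rewrite mulr_ge0// expR_ge0.
Qed.

Lemma transfer_le P n (u v : X n -> R) : adm P ->
  (forall x, u x <= v x) -> forall x, transfer P n u x <= transfer P n v x.
Proof.
move=> aP uv x; rewrite /transfer; apply: ler_fsum => [|y _].
  exact: adm_fibre_finite.
by rewrite ler_wpM2l// expR_ge0.
Qed.

Lemma transfer_ge P n (g : X n -> R) y : adm P -> (forall x, 0 <= g x) ->
  expR (- V) * g y <= transfer P n g (smap P n y).
Proof.
move=> aP g0; have fS := @adm_fibre_finite P n (smap P n y) aP.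
apply: le_trans (_ : _ <= \sum_(z \in [set y]) expR (spot P n z) * g z) _.
  rewrite fsbig_set1 ler_wpM2r// ler_expR.
  by have := adm_spot_bound y aP; rewrite ler_norml => /andP[].
apply: ler_fsum_subset => // [z -> //|z _].
by rewrite mulr_ge0// expR_ge0.
Qed.

Lemma transfer_ub P n (g : X n -> R) B : adm P -> 0 <= B ->
  (forall x, g x <= B) ->
  forall x, transfer P n g x <= D%:R * expR V * B.
Proof.
move=> aP B0 gB x; rewrite -mulrA; apply: ler_fsum_card.
- by have [] := adm_fibre aP x.
- by rewrite mulr_ge0// expR_ge0.
- move=> y _; apply: (@le_trans _ _ (expR (spot P n y) * B)).
    by rewrite ler_wpM2l// expR_ge0.
  rewrite ler_wpM2r// ler_expR.
  by have := adm_spot_bound y aP; rewrite ler_norml => /andP[].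
Qed.

(** A point [y] of the fibre of [T] over [x] is moved by [T'] at distance at
    most [eta + d(x, x')] from [x'], so the covering property of [T'] lifts
    [x'] to a preimage [j y] close to [y]; the expansion property brings it
    closer by the factor [rho]. *)
Lemma preimage_matching P P' n (eta : R) (x x' : X (n + 1)) :
  adm P -> adm P' ->
  (forall y, mdist (smap P n y) (smap P' n y) <= eta) ->
  eta + mdist x x' <= delta ->
  exists j : X n -> X n, forall y, smap P n y = x ->
    smap P' n (j y) = x' /\ mdist y (j y) <= rho * (eta + mdist x x').
Proof.
move=> aP aP' hT hd.
have h y : exists z, smap P n y = x ->
    smap P' n z = x' /\ mdist y z <= rho * (eta + mdist x x').
  have [Tyx|?] := pselect (smap P n y = x); last by exists y.
  have d1 : mdist (smap P' n y) x' <= eta + mdist x x'.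
    apply: (le_trans (metric_triangle _ x _)); rewrite lerD2r -Tyx.
    by rewrite metric_sym hT.
  have [z yz zx'] := adm_cover aP' (le_trans d1 hd).
  exists z => _; split=> //; apply: (le_trans (adm_expand aP' yz)).
  by rewrite zx' ler_wpM2l// ltW//; case/andP: rho01.
by exists (fun y => projT1 (cid (h y))) => y; exact: (projT2 (cid (h y))).
Qed.

(** The expansion property makes each map injective on sets of diameter at most
    [delta]. *)
Lemma adm_fibre_separated P n (y1 y2 : X n) : adm P ->
  smap P n y1 = smap P n y2 -> mdist y1 y2 <= delta -> y1 = y2.
Proof.
move=> aP e /(adm_expand aP); rewrite e mdistxx mulr0 => h.
by apply: mdist_positivity; apply/eqP; rewrite eq_le h mdist_ge0.
Qed.

(** Comparison of the two operators at nearby points. The matching of the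
    fibres is injective when [2 (eta + d(x, x')) <= delta], since points of a
    fibre are equal or more than [delta] apart; beyond that scale it can
    identify points, and the bound on the size of the fibres costs a factor
    [D]. *)
Lemma transfer_compare P P' n (eta a Q : R) (g : X n -> R) (x x' : X (n + 1)) :
  adm P -> adm P' -> 0 <= Q -> reg Q g -> 0 <= eta ->
  (forall y, mdist (smap P n y) (smap P' n y) <= eta) ->
  (forall y, `|spot P n y - spot P' n y| <= a) ->
  eta + mdist x x' <= delta ->
  let E := expR (a + (H + Q) * (rho * (eta + mdist x x')) `^ beta) in
  transfer P n g x <= D%:R * (E * transfer P' n g x') /\
  (2 * (eta + mdist x x') <= delta ->
    transfer P n g x <= E * transfer P' n g x').
Proof.
move=> aP aP' Q0 [g0 gQ] eta0 hT hphi hd; set s := eta + mdist x x' => E.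
have [rho0 rho1] : 0 <= rho /\ rho <= 1 by case/andP: rho01 => /ltW ? /ltW.
have s0 : 0 <= s by rewrite addr_ge0// mdist_ge0.
have rs : rho * s <= delta by apply: le_trans hd; rewrite ler_piMl.
have [j hj] := preimage_matching aP aP' hT hd.
have w y : smap P n y = x ->
    expR (spot P n y) * g y <= E * (expR (spot P' n (j y)) * g (j y)).
  move=> /hj[_ yjy]; have d1 : mdist y (j y) <= delta := le_trans yjy rs.
  rewrite mulrA -expRD.
  have hb : mdist y (j y) `^ beta <= (rho * s) `^ beta.
    apply: ge0_ler_powR; rewrite ?nnegrE ?mdist_ge0 ?mulr_ge0//.
    by apply: ltW; case/andP: beta01.
  apply: (le_trans (ler_wpM2l (expR_ge0 _) (gQ _ _ d1))).
  rewrite mulrA -expRD ler_wpM2r// ler_expR.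
  have := hphi y; have := adm_pot_holder aP' d1.
  rewrite !ler_norml => /andP[_ h1] /andP[_ h2].
  have h3 : (H + Q) * mdist y (j y) `^ beta <= (H + Q) * (rho * s) `^ beta.
    by rewrite ler_wpM2l// addr_ge0// ltW.
  by rewrite -/s; lra.
have pos y : 0 <= expR (spot P' n y) * g y by rewrite mulr_ge0// expR_ge0.
split=> [|hs].
- apply: ler_fsum_card; first by have [] := adm_fibre aP x.
    by rewrite mulr_ge0 ?expR_ge0//; exact: transfer_ge0.
  move=> y yx; apply: (le_trans (w _ yx)); rewrite ler_wpM2l ?expR_ge0//.
  apply: le_trans
    (_ : _ <= \sum_(z \in [set j y]) expR (spot P' n z) * g z) _.
    by rewrite fsbig_set1.
  apply: ler_fsum_subset => //; first exact: adm_fibre_finite.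
  by move=> z ->; case: (hj _ yx).
- apply: (@ler_fsum_inj _ _ _ _ _ j) => //.
  + exact: adm_fibre_finite.
  + exact: adm_fibre_finite.
  + move=> y1 y2; rewrite !inE => h1 h2 j12.
    have [_ d1] := hj _ h1; have [_ d2] := hj _ h2.
    apply: (adm_fibre_separated aP); first by rewrite h1 h2.
    apply: (le_trans (metric_triangle _ (j y1) _)).
    rewrite {2}j12 (metric_sym (j y2)); rewrite -/s in d1 d2.
    have : rho * s <= s by rewrite ler_piMl.
    by lra.
  + exact: expR_ge0.
  + by move=> y yx; split; [case: (hj _ yx)|exact: w].
Qed.

(** The exponent contributed by one step: the potential gives [H], and a factor
    [D] at distances [d] larger than [delta / 2] costs at most [expR (D * (2 /
    delta) ^ beta * d ^ beta)]. *)
Definition gain : R := H + D%:R * (2 / delta) `^ beta.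

(** Preimages are closer than their images by the factor [rho], so the exponent
    is multiplied by [rho ^ beta], up to [gain]. *)
Lemma transfer_regular P n (Q : R) (g : X n -> R) : adm P -> 0 <= Q ->
  reg Q g -> reg (rho `^ beta * Q + gain) (transfer P n g).
Proof.
move=> aP Q0 gQ; have [rho0 rho1] : 0 <= rho /\ rho <= 1.
  by case/andP: rho01 => /ltW ? /ltW.
have [b0 b1] := andP beta01.
split=> [|x x' dx]; first by apply: transfer_ge0; case: gQ.
have hT y : mdist (smap P n y) (smap P n y) <= 0 by rewrite mdistxx.
have hphi y : `|spot P n y - spot P n y| <= 0 by rewrite subrr normr0.
have hd : 0 + mdist x x' <= delta by rewrite add0r.
have /= := transfer_compare aP aP Q0 gQ (lexx 0) hT hphi hd.
rewrite !add0r powRM ?mdist_ge0// => -[h1 h2].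
set d := mdist x x' in dx h1 h2 *.
have rb0 : 0 <= rho `^ beta := powR_ge0 _ _.
have rb1 : rho `^ beta <= 1.
  by rewrite -(powRr0 rho) ger_powR ?(ltW b0)//; case/andP: rho01 => -> /ltW.
have db0 : 0 <= d `^ beta := powR_ge0 _ _.
have HQ : (H + Q) * (rho `^ beta * d `^ beta) <=
    rho `^ beta * Q * d `^ beta + H * d `^ beta.
  rewrite mulrDl addrC [Q * _]mulrA [Q * _]mulrC lerD2l ler_wpM2l ?(ltW H_gt0)//.
  by rewrite ler_piMl.
have t0 := transfer_ge0 P gQ.1 x'.
have [{}hd|{}hd] := leP (2 * d) delta.
  apply: (le_trans (h2 hd)); rewrite ler_wpM2r// ler_expR.
  apply: (le_trans HQ); rewrite -mulrDl ler_wpM2r// lerD2l /gain lerDl.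
  by rewrite mulr_ge0// powR_ge0.
apply: (le_trans h1); rewrite mulrA ler_wpM2r//.
have Db : D%:R * 1 <= D%:R * ((2 / delta) `^ beta * d `^ beta).
  rewrite ler_wpM2l// -powRM ?mdist_ge0 ?divr_ge0 ?(ltW delta_gt0)//.
  have e1 : 1 `^ beta = 1 :> R by rewrite powR1.
  rewrite -[leLHS]e1; apply: ge0_ler_powR; first exact: ltW.
  - by rewrite nnegrE.
  - by rewrite nnegrE mulr_ge0 ?mdist_ge0// divr_ge0// ltW.
  - by rewrite mulrAC ler_pdivlMr// mul1r ltW.
apply: (@le_trans _ _ (expR D%:R * expR ((H + Q) * (rho `^ beta * d `^ beta)))).
  rewrite ler_wpM2r ?expR_ge0//.
  by have := expR_ge1Dx (D%:R : R); lra.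
rewrite -expRD ler_expR [(_ + gain) * _]mulrDl /gain [(H + D%:R * _) * _]mulrDl.
by move: Db HQ; rewrite mulr1 !mulrA; lra.
Qed.

(** The case [x = x'] of the comparison, where only the systems differ. *)
Lemma transfer_perturb P P' n (eta Q : R) (g : X n -> R) :
  adm P -> adm P' -> 0 <= Q -> reg Q g -> 0 <= eta -> 2 * eta <= delta ->
  (forall y, mdist (smap P n y) (smap P' n y) <= eta) ->
  (forall y, `|spot P n y - spot P' n y| <= eta) ->
  forall x, transfer P n g x <=
    expR (eta + (H + Q) * eta `^ beta) * transfer P' n g x.
Proof.
move=> aP aP' Q0 gQ eta0 eta2 hT hphi x.
have [rho0 rho1] : 0 <= rho /\ rho <= 1 by case/andP: rho01 => /ltW ? /ltW.
have [b0 b1] := andP beta01.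
have [|_] := transfer_compare aP aP' Q0 gQ eta0 hT hphi (x := x) (x' := x).
  by rewrite mdistxx addr0; lra.
rewrite mdistxx addr0 => /(_ eta2) /le_trans; apply.
rewrite ler_wpM2r ?(transfer_ge0 P' gQ.1)// ler_expR lerD2l ler_wpM2l//.
  by rewrite addr_ge0// ltW.
apply: ge0_ler_powR; rewrite ?nnegrE ?mulr_ge0// ?(ltW b0)//.
by rewrite ler_piMl.
Qed.

End transfer.

(** * Contraction *)

Lemma onem_expn_le (R : realType) (y : R) m :
  0 <= y <= 1 -> 1 - y ^+ m <= m%:R * (1 - y).
Proof.
move=> /andP[y0 y1]; elim: m => [|m IH]; first by rewrite expr0 mul0r subrr.
have : y ^+ m * (1 - y) <= 1 - y.
  by rewrite ler_piMl ?subr_ge0// exprn_ile1.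
by rewrite exprS -natr1 mulrDl; lra.
Qed.

Section subtraction.
Variables (R : realType) (delta beta Q rate A : R) (m : nat).
Hypotheses (Q_gt0 : 0 < Q) (rate01 : 0 < rate < 1) (A1 : 1 <= A)
  (m_large : 2 <= m%:R * (1 - rate)).
Local Notation reg := (regular delta beta).

(** Dividing by [e^t] and setting [y = e^(- (1 - rate) t)], the left side is at
    most [1 - y ^ m], because [m * (1 - rate) >= 2 >= 1 + rate], and
    Bernoulli's inequality bounds it by [m * (1 - y)]. *)
Lemma expR_gap_le t : 0 <= t ->
  expR t - expR (- (rate * t)) <= m%:R * (expR t - expR (rate * t)).
Proof.
move=> t0; have [r0 r1] := andP rate01.
set y := expR (- ((1 - rate) * t)).
have y01 : 0 <= y <= 1.
  by rewrite expR_ge0 -expR0 ler_expR oppr_le0 mulr_ge0// subr_ge0 ltW.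
have e1 : expR (rate * t) = expR t * y by rewrite -expRD; congr expR; ring.
have e2 : expR t * y ^+ m <= expR (- (rate * t)).
  rewrite -expRM_natl -expRD ler_expR.
  have : 2 * t <= m%:R * (1 - rate) * t by rewrite ler_wpM2r.
  have : rate * t <= t by rewrite ler_piMl// ltW.
  by lra.
have := onem_expn_le m y01; rewrite -(ler_pM2l (expR_gt0 t)) e1.
move: e2; clearbody y; move: (y ^+ m) (expR t) (expR (- _)) => ym E F.
by lra.
Qed.

(** Among functions that are comparable to a constant and regular with the
    smaller exponent [rate * Q], a small multiple of one can be subtracted from
    another without leaving the cone of exponent [Q]: they form a set of
    bounded projective diameter in that cone. *)
Lemma regular_sub (M : metricType R) (p q : M -> R) (c : R) (x0 : M) :
  reg (rate * Q) p -> reg (rate * Q) q ->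
  (forall x y, p x <= A * p y) -> (forall x y, q x <= A * q y) ->
  0 <= c -> c * q x0 <= (A ^+ 2 * m%:R)^-1 * p x0 ->
  reg Q (fun x => p x - c * q x).
Proof.
move=> [p0 pQ] [q0 qQ] pA qA c0 cpq.
have [r0 r1] := andP rate01.
have A0 : 0 < A by apply: lt_le_trans A1.
have m0 : (0 : R) < m%:R.
  rewrite -(@pmulr_lgt0 _ (1 - rate)) ?subr_gt0//.
  exact: lt_le_trans m_large.
have cq x : m%:R * (c * q x) <= p x.
  have h1 : c * q x <= c * (A * q x0) by rewrite ler_wpM2l.
  have h2 : A * (c * q x0) <= A * ((A ^+ 2 * m%:R)^-1 * p x0).
    by rewrite ler_wpM2l// ltW.
  have h3 : A * ((A ^+ 2 * m%:R)^-1 * p x0) <= A * ((A ^+ 2 * m%:R)^-1 * (A * p x)).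
    by rewrite ler_pM2l// ler_pM2l// invr_gt0 mulr_gt0// exprn_gt0.
  have e : A * ((A ^+ 2 * m%:R)^-1 * (A * p x)) = m%:R^-1 * p x.
    by field; rewrite !gt_eqF.
  by rewrite mulrC -ler_pdivlMr// [leRHS]mulrC; lra.
have m1 : (1 : R) <= m%:R by rewrite ler1n -(ltr0n R).
split=> [x|x x' xx'].
  rewrite subr_ge0; apply: le_trans (cq x).
  by rewrite ler_peMl// mulr_ge0.
set t := Q * mdist x x' `^ beta.
have hp : p x <= expR (rate * t) * p x' by rewrite /t mulrA pQ.
have hq : q x' <= expR (rate * t) * q x.
  by rewrite /t mulrA metric_sym qQ// metric_sym.
have t0 : 0 <= t by rewrite mulr_ge0 ?powR_ge0// ltW.
have hq' : c * (expR (- (rate * t)) * q x') <= c * q x.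
  by rewrite ler_wpM2l// expRN mulrC ler_pdivrMr ?expR_gt0// mulrC.
have gap := expR_gap_le t0.
have cq0 : 0 <= c * q x' by rewrite mulr_ge0.
have h1 := ler_wpM2r cq0 gap.
have h2 : (expR t - expR (rate * t)) * (m%:R * (c * q x')) <=
    (expR t - expR (rate * t)) * p x'.
  by rewrite ler_wpM2l// subr_ge0 ler_expR ler_piMl// ltW.
clearbody t; move: (expR t) (expR (rate * t)) (expR (- _)) hp hq' h1 h2.
move=> E F G; lra.
Qed.

End subtraction.


(** * Integration of continuous functions on compact spaces *)

Section integration.
Variables (R : realType) (X : int -> pmetricType R).
Hypothesis cX : forall n : int, compact [set: X n].

Lemma continuous_borel_integrable n (mu : {measure set (borel (X n)) -> \bar R})
    (g : X n -> R) :
  (mu setT < +oo)%E -> continuous g -> mu.-integrable setT (EFin \o g).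
Proof.
move=> mufin cg; apply: measurable_bounded_integrable => //.
- apply: (measurability _ (measurable_realfun.RGenOpens.measurableE R)).
  move=> _ [_ [a [b ->] <-]]; rewrite setTI.
  apply: sub_sigma_algebra.
  by move/continuousP : cg; apply; exact: interval_open.
- have /compact_bounded[M [Mr hM]] : compact (g @` [set: X n]).
    by apply: continuous_compact => //; exact: continuous_subspaceT.
  by exists M; split => // x Mx y _; apply: hM Mx _ _; exists y.
Qed.

Lemma pairing_le n (mu : {measure set (borel (X n)) -> \bar R}) (u v : X n -> R) :
  (mu setT < +oo)%E -> continuous u -> continuous v ->
  (forall x, u x <= v x) -> pairing u mu <= pairing v mu.
Proof.
by move=> mufin cu cv uv; apply: le_Rintegral => //; exact: continuous_borel_integrable.
Qed.

Lemma pairingZ n (mu : {measure set (borel (X n)) -> \bar R}) c (u : X n -> R) :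
  (mu setT < +oo)%E -> continuous u ->
  pairing (fun x => c * u x) mu = c * pairing u mu.
Proof.
by move=> mufin cu; apply: RintegralZl => //; exact: continuous_borel_integrable.
Qed.

Lemma pairing_cst n (mu : {measure set (borel (X n)) -> \bar R}) c :
  pairing (cst c) mu = c * fine (mu setT).
Proof. exact: Rintegral_cst. Qed.

Lemma pairing_probability_cst n (mu : probability (borel (X n)) R) c :
  pairing (cst c) mu = c.
Proof.
rewrite pairing_cst [X in _ * X](_ : _ = 1) ?mulr1//.
exact: (congr1 fine (probability_setT mu)).
Qed.

Lemma probability_fin n (mu : probability (borel (X n)) R) : (mu setT < +oo)%E.
Proof. exact: (eq_ind_r (fun z => (z < +oo)%E) (ltry 1) (probability_setT mu)). Qed.

Lemma pairing_near n (mu : probability (borel (X n)) R) (u v : X n -> R) e :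
  continuous u -> continuous v -> (forall x, `|u x - v x| <= e) ->
  `|pairing u mu - pairing v mu| <= e.
Proof.
move=> cu cv uv; have mufin := probability_fin mu.
have D (w : X n -> R) : continuous w ->
    pairing (fun x => w x + e) mu = pairing w mu + e.
  move=> cw; rewrite -[in RHS](pairing_probability_cst mu e).
  by apply: RintegralD => //; apply: continuous_borel_integrable => // x; exact: cvg_cst.
have cD (w : X n -> R) : continuous w -> continuous (fun x => w x + e).
  by move=> cw x; apply: cvgD; [exact: cw|exact: cvg_cst].
have h1 : pairing u mu <= pairing v mu + e.
  rewrite -D//; apply: pairing_le => // [|x]; first exact: cD.
  by have := uv x; rewrite ler_norml => /andP[]; lra.
have h2 : pairing v mu <= pairing u mu + e.
  rewrite -D//; apply: pairing_le => // [|x]; first exact: cD.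
  by have := uv x; rewrite ler_norml => /andP[]; lra.
by rewrite ler_norml; apply/andP; split; lra.
Qed.

End integration.
Section dynamics.
Variables (R : realType) (X : int -> pmetricType R) (D tau : nat).
Variables (delta rho beta H V : R).
Hypotheses (delta_gt0 : 0 < delta) (rho01 : 0 < rho < 1)
  (beta01 : 0 < beta < 1) (H_gt0 : 0 < H).
Local Notation adm := (admissible D tau delta rho beta H V).
Local Notation reg := (regular delta beta).

Lemma transfer_iter_lin P n k (a b : R) (u v : X n -> R) : adm P ->
  transfer_iter P n k (fun x => a * u x + b * v x) =
  (fun x => a * transfer_iter P n k u x + b * transfer_iter P n k v x).
Proof. by move=> aP; elim: k => //= k ->; exact: (transfer_lin _ _ _ _ aP). Qed.

Lemma transfer_iter_ge0 P n k (g : X n -> R) : (forall x, 0 <= g x) ->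
  forall x, 0 <= transfer_iter P n k g x.
Proof. by move=> g0; elim: k => //= k IH; exact: transfer_ge0. Qed.

Lemma transfer_iter_ge P n k (g : X n -> R) z : adm P -> (forall x, 0 <= g x) ->
  expR (- V) ^+ k * g z <= transfer_iter P n k g (smap_iter P n k z).
Proof.
move=> aP g0; elim: k => [|k IH] /=; first by rewrite expr0 mul1r.
have := transfer_ge (smap_iter P n k z) aP (transfer_iter_ge0 P g0).
apply: le_trans.
by rewrite exprS -mulrA ler_wpM2l// expR_ge0.
Qed.

Lemma transfer_iter_ub P n k (g : X n -> R) B : adm P -> 0 <= B ->
  (forall x, g x <= B) ->
  forall x, transfer_iter P n k g x <= (D%:R * expR V) ^+ k * B.
Proof.
move=> aP B0 gB; elim: k => [|k IH] /= x; first by rewrite expr0 mul1r.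
rewrite exprS -mulrA; apply: (transfer_ub aP) => //.
by rewrite mulr_ge0// exprn_ge0// mulr_ge0// expR_ge0.
Qed.

(** Induction principle hiding the casts between [X (fwd n (l + k))] and [X
    (fwd (fwd n k) l)]. *)
Lemma transfer_iterD_ind P n k l
    (Phi : forall i, ((X n -> R) -> X i -> R) -> Prop) :
  Phi (fwd (fwd n k) l)
    (fun u => transfer_iter P (fwd n k) l (transfer_iter P n k u)) ->
  Phi (fwd n (l + k)) (fun u => transfer_iter P n (l + k) u).
Proof.
elim: l Phi => [//|l IH] Phi h.
exact: (IH (fun i A => Phi (i + 1) (fun u => transfer P i (A u))) h).
Qed.

Variables (Q rate : R).
Hypotheses (Q_gt0 : 0 < Q) (rate01 : 0 < rate < 1)
  (Q_large : rho `^ beta * Q + gain D delta beta H <= rate * Q).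

Lemma transfer_regularQ P n (g : X n -> R) : adm P -> reg Q g ->
  reg (rate * Q) (transfer P n g).
Proof.
move=> aP gQ; apply: (regular_le Q_large).
exact: (transfer_regular delta_gt0 rho01 beta01 H_gt0 aP (ltW Q_gt0) gQ).
Qed.

Lemma regular_rate (M : metricType R) (g : M -> R) :
  reg (rate * Q) g -> reg Q g.
Proof.
apply: regular_le; rewrite ler_piMl//; first exact: ltW.
by case/andP: rate01 => _ /ltW.
Qed.

Lemma transfer_iter_regular P n k (g : X n -> R) : adm P -> reg Q g ->
  reg Q (transfer_iter P n k g).
Proof.
move=> aP gQ; elim: k => //= k IH.
exact/regular_rate/transfer_regularQ.
Qed.

Definition floor_const : R := expR (Q * delta `^ beta) * expR V ^+ tau.+1.

(** By exactness, [y] is the image of a point within [delta] of [z], where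
    regularity compares the values of [g]. *)
Lemma transfer_iter_floor P n (g : X n -> R) z y : adm P -> reg Q g ->
  g z <= floor_const * transfer_iter P n tau.+1 g y.
Proof.
move=> aP [g0 gQ] /=.
have [[y0 yE] _] := adm_fibre aP y.
have : [set: X (fwd n tau)] y0 by [].
rewrite -(adm_exact aP z) => -[z' zz' z'y0].
have h1 : g z <= expR (Q * delta `^ beta) * g z'.
  apply: (le_trans (gQ _ _ zz')); rewrite ler_wpM2r// ler_expR ler_wpM2l ?(ltW Q_gt0)//.
  apply: ge0_ler_powR; rewrite ?nnegrE ?mdist_ge0 ?(ltW delta_gt0)//.
  by case/andP: beta01 => /ltW.
have h2 := transfer_iter_ge tau.+1 z' aP g0.
have {}h2 : g z' <= expR V ^+ tau.+1 *
    transfer_iter P n tau.+1 g (smap_iter P n tau.+1 z').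
  rewrite mulrC -ler_pdivrMr ?exprn_gt0 ?expR_gt0// -exprVn -expRN mulrC.
  exact: h2.
rewrite /floor_const -mulrA; apply: (le_trans h1).
rewrite ler_wpM2l ?expR_ge0//; apply: (le_trans h2).
by rewrite /= z'y0 (_ : smap P _ y0 = y).
Qed.

Lemma floor_const_gt0 : 0 < floor_const.
Proof. by rewrite mulr_gt0 ?exprn_gt0 ?expR_gt0. Qed.

(** The summand [1] makes this constant at least [1]. *)
Definition harnack_const : R :=
  1 + (D%:R * expR V) ^+ tau.+1 * floor_const.

Lemma harnack_const_ge1 : 1 <= harnack_const.
Proof.
by rewrite lerDl mulr_ge0 ?(ltW floor_const_gt0)// exprn_ge0.
Qed.

(** The image at [x] is at most a constant times the largest value of [g], and
    the image at [y] is at least a constant times any value of [g]. *)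
Lemma transfer_iter_harnack P n (g : X n -> R) x y : adm P -> reg Q g ->
  transfer_iter P n tau.+1 g x <= harnack_const * transfer_iter P n tau.+1 g y.
Proof.
move=> aP gQ; have t0 := transfer_iter_ge0 P gQ.1 y.
apply: (@le_trans _ _ ((D%:R * expR V) ^+ tau.+1 *
    (floor_const * transfer_iter P n tau.+1 g y))).
  apply: transfer_iter_ub => //.
    by rewrite mulr_ge0// ltW// floor_const_gt0.
  by move=> z; exact: transfer_iter_floor.
by rewrite mulrA ler_wpM2r// lerDr.
Qed.

Lemma transfer_iter_gt0 P n (g : X n -> R) x y : adm P -> reg Q g ->
  g x != 0 -> 0 < transfer_iter P n tau.+1 g y.
Proof.
move=> aP gQ gx0; have gx : 0 < g x by rewrite lt_neqAle eq_sym gx0 gQ.1.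
rewrite -(pmulr_rgt0 _ floor_const_gt0).
exact: (lt_le_trans gx (transfer_iter_floor _ _ aP gQ)).
Qed.

Variable mult : nat.
Hypothesis mult_large : 2 <= mult%:R * (1 - rate).

(** The proportion of one function that can be subtracted from another one of
    comparable size. *)
Definition gap_const : R := (harnack_const ^+ 2 * mult%:R)^-1.

Lemma gap_const01 : 0 < gap_const <= 1.
Proof.
have mult1 : (1 : R) <= mult%:R.
  rewrite ler1n -(ltr0n R) -(@pmulr_lgt0 _ (1 - rate)).
    exact: lt_le_trans mult_large.
  by rewrite subr_gt0; case/andP: rate01.
have A1 := harnack_const_ge1.
have h : 1 <= harnack_const ^+ 2 * mult%:R.
  by apply: (le_trans mult1); rewrite ler_peMl// exprn_ege1.
by rewrite invr_gt0 invf_le1 ?h ?andbT (lt_le_trans _ h).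
Qed.

(** In the order of the cone, [a * v <= u <= b * v] with [b / a - 1 <= e]. *)
Definition pinched (e : R) (M : metricType R) (u v : M -> R) : Prop :=
  exists a b : R, [/\ 0 < a, a <= b, b - a <= e * a,
    reg Q (fun x => u x - a * v x) & reg Q (fun x => b * v x - u x)].

(** The initial bounds [a] and [b] are the ratio of the two functions at a base
    point, multiplied and divided by [gap_const]. *)
Lemma pinched_init P n (f g : X n -> R) x y : adm P -> reg Q f -> reg Q g ->
  f x != 0 -> g y != 0 ->
  pinched (gap_const ^- 2)
    (transfer_iter P n tau.+1 f) (transfer_iter P n tau.+1 g).
Proof.
move=> aP fQ gQ fx gy; set p := transfer_iter _ _ _ f.
set q := transfer_iter _ _ _ g; pose x0 : X (fwd n tau.+1) := point.
have p0 : 0 < p x0 by exact: transfer_iter_gt0 fx.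
have q0 : 0 < q x0 by exact: transfer_iter_gt0 gy.
have pr : reg (rate * Q) p.
  exact: (transfer_regularQ aP (transfer_iter_regular tau aP fQ)).
have qr : reg (rate * Q) q.
  exact: (transfer_regularQ aP (transfer_iter_regular tau aP gQ)).
have pA z t : p z <= harnack_const * p t by exact: transfer_iter_harnack.
have qA z t : q z <= harnack_const * q t by exact: transfer_iter_harnack.
have [g0 g1] := andP gap_const01.
have sub := @regular_sub R delta beta _ _ _ _ Q_gt0 rate01
  harnack_const_ge1 mult_large.
pose r := p x0 / q x0; have r0 : 0 < r by rewrite divr_gt0.
exists (gap_const * r), (gap_const^-1 * r); split.
- by rewrite mulr_gt0.
- by rewrite ler_pM2r//; apply: (le_trans g1); rewrite invf_ge1.
- have -> : gap_const ^- 2 * (gap_const * r) = gap_const^-1 * r.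
    by field; rewrite gt_eqF.
  by rewrite gerBl mulr_ge0// ltW.
- apply: (sub _ p q _ x0) => //; first by rewrite mulr_ge0// ltW.
  by rewrite -mulrA divfK// gt_eqF.
- have h : reg Q (fun x => q x - gap_const / r * p x).
    apply: (sub _ q p _ x0) => //; first by rewrite divr_ge0// ltW.
    by rewrite /r invf_div mulrA divfK// gt_eqF.
  have c0 : 0 <= gap_const^-1 * r by rewrite mulr_ge0 ?(ltW r0)// (@invr_ge0 _ gap_const) ltW.
  have := regularZ c0 h; congr (reg _ _); apply/funext => z.
  by field; rewrite /r !gt_eqF// divr_gt0.
Qed.

(** The images of the differences [u - a * v] and [b * v - u] under a block of
    [tau + 1] steps add up to that of [(b - a) * v], so at a base point one of
    them is at least half of it, and a fixed proportion of the image of [(b -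
    a) * v] can be subtracted from it. *)
Lemma pinched_step P n (e : R) (u v : X n -> R) : adm P -> reg Q v ->
  pinched e u v ->
  pinched (e * (1 - gap_const / 2))
    (transfer_iter P n tau.+1 u) (transfer_iter P n tau.+1 v).
Proof.
move=> aP vQ [a [b [a0 ab bae ua vb]]].
set p := transfer_iter P n tau.+1 u; set q := transfer_iter P n tau.+1 v.
have [g0 g1] := andP gap_const01.
have sub := @regular_sub R delta beta _ _ _ _ Q_gt0 rate01
  harnack_const_ge1 mult_large.
have pE : transfer_iter P n tau.+1 (fun x => u x - a * v x) =
    (fun x => p x - a * q x).
  rewrite (_ : (fun x => _) = (fun x => 1 * u x + (- a) * v x)); last first.
    by apply/funext => z; ring.
  by rewrite transfer_iter_lin//; apply/funext => z; rewrite mul1r mulNr.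
have qE : transfer_iter P n tau.+1 (fun x => b * v x - u x) =
    (fun x => b * q x - p x).
  rewrite (_ : (fun x => _) = (fun x => b * v x + (- 1) * u x)); last first.
    by apply/funext => z; ring.
  by rewrite transfer_iter_lin//; apply/funext => z; rewrite mulN1r.
have blockreg (w : X n -> R) : reg Q w ->
    reg (rate * Q) (transfer_iter P n tau.+1 w).
  by move=> wQ; exact: (transfer_regularQ aP (transfer_iter_regular tau aP wQ)).
have par := blockreg _ ua; have qbr := blockreg _ vb; have qr := blockreg _ vQ.
have paA x y := transfer_iter_harnack x y aP ua.
have qbA x y := transfer_iter_harnack x y aP vb.
have qA x y := transfer_iter_harnack x y aP vQ.
rewrite pE in par paA; rewrite qE in qbr qbA.
pose x0 : X (fwd n tau.+1) := point.
pose c := gap_const / 2 * (b - a).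
have c0 : 0 <= c by rewrite mulr_ge0 ?subr_ge0// divr_ge0// ltW.
have q0 : 0 <= q x0 := qr.1 x0.
have ca : (e * (1 - gap_const / 2)) * a = (1 - gap_const / 2) * (e * a) by ring.
have cb : (1 - gap_const / 2) * (b - a) <= (1 - gap_const / 2) * (e * a).
  by rewrite ler_wpM2l//; lra.
have cba : c <= b - a by rewrite /c ler_piMl ?subr_ge0//; lra.
have eba : 0 <= e * a by apply: le_trans bae; rewrite subr_ge0.
have [hu|hv] := leP ((b - a) / 2 * q x0) (p x0 - a * q x0).
- exists (a + c), b; split.
  + by rewrite ltr_wpDr.
  + by lra.
  + have -> : b - (a + c) = (1 - gap_const / 2) * (b - a) by rewrite /c; ring.
    apply: (le_trans cb); rewrite -ca ler_wpM2l ?lerDl//.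
    rewrite -(pmulr_lge0 _ a0) ca mulr_ge0//; lra.
  + have : reg Q (fun x => (p x - a * q x) - c * q x).
      apply: (sub _ _ q _ x0) => //.
      rewrite /c -[X in X * q x0]mulrA -[leLHS]mulrA ler_pM2l//.
      by rewrite -mulrA mulrCA mulrA.
    by congr (reg _ _); apply/funext => z; ring.
  + exact: regular_rate.
- exists a, (b - c); split=> //.
  + by lra.
  + have -> : b - c - a = (1 - gap_const / 2) * (b - a) by rewrite /c; ring.
    by rewrite ca.
  + exact: regular_rate.
  + have : reg Q (fun x => (b * q x - p x) - c * q x).
      apply: (sub _ _ q _ x0) => //.
      rewrite /c -[X in X * q x0]mulrA -[leLHS]mulrA ler_pM2l//.
      by move: hv; lra.
    by congr (reg _ _); apply/funext => z; ring.
Qed.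

Definition theta : R := 1 - gap_const / 2.

Lemma theta01 : 0 < theta < 1.
Proof. by have := gap_const01; rewrite /theta; lra. Qed.

Lemma transfer_iter_pinched P n J (f g : X n -> R) x y : adm P ->
  reg Q f -> reg Q g -> f x != 0 -> g y != 0 ->
  pinched (gap_const ^- 2 * theta ^+ J)
    (transfer_iter P n (J.+1 * tau.+1) f) (transfer_iter P n (J.+1 * tau.+1) g).
Proof.
move=> aP fQ gQ fx gy; elim: J => [|J IH].
  rewrite expr0 mulr1.
  exact: (@transfer_iterD_ind P n 0 tau.+1
    (fun i A => pinched (gap_const ^- 2) (A f) (A g)) (pinched_init aP fQ gQ fx gy)).
apply: (@transfer_iterD_ind P n (J.+1 * tau.+1) tau.+1
  (fun i A => pinched (gap_const ^- 2 * theta ^+ J.+1) (A f) (A g))).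
rewrite [theta ^+ _]exprSr mulrA; apply: pinched_step => //.
exact: transfer_iter_regular.
Qed.

(** Exponential loss of memory: up to a constant multiple, the images of two
    regular functions become indistinguishable. *)
Lemma transfer_iter_memory P n J (f g : X n -> R) x y : adm P ->
  reg Q f -> reg Q g -> f x != 0 -> g y != 0 ->
  exists2 a : R, 0 < a & forall z,
    a * transfer_iter P n (J.+1 * tau.+1) g z <=
      transfer_iter P n (J.+1 * tau.+1) f z <=
    expR (gap_const ^- 2 * theta ^+ J) * a *
      transfer_iter P n (J.+1 * tau.+1) g z.
Proof.
move=> aP fQ gQ fx gy.
have [a [b [a0 ab bae ua vb]]] := transfer_iter_pinched J aP fQ gQ fx gy.
exists a => // z; have := ua.1 z; have := vb.1 z; rewrite !subr_ge0 => h1 ->.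
apply: (le_trans h1); rewrite ler_wpM2r//; first exact: (transfer_iter_ge0 P gQ.1 _).
have : a * (1 + gap_const ^- 2 * theta ^+ J) <=
    a * expR (gap_const ^- 2 * theta ^+ J).
  by rewrite ler_pM2l// expR_ge1Dx.
by lra.
Qed.


(** * Eigendata *)

Hypothesis cX : forall n : int, compact [set: X n].

Let beta_gt0 : 0 < beta. Proof. by case/andP: beta01. Qed.

Local Notation reg_cont := (regular_continuous delta_gt0 beta_gt0 Q_gt0).

Lemma transfer_regQ P n (g : X n -> R) : adm P -> reg Q g ->
  reg Q (transfer P n g).
Proof. exact: (@transfer_iter_regular P n 1). Qed.

Lemma regular1 n : reg Q (cst 1 : X n -> R).
Proof. by apply: regular_cst1; exact: ltW. Qed.

Lemma transfer_lb P n (g : X n -> R) c : adm P -> 0 <= c ->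
  (forall x, c <= g x) -> forall x, expR (- V) * c <= transfer P n g x.
Proof.
move=> aP c0 cg x; have [[y <-] _] := adm_fibre aP x.
apply: le_trans (transfer_ge y aP (fun z => le_trans c0 (cg z))).
by rewrite ler_wpM2l// expR_ge0.
Qed.

Lemma transfer_iter_lb P n k (g : X n -> R) c : adm P -> 0 <= c ->
  (forall x, c <= g x) ->
  forall x, expR (- V) ^+ k * c <= transfer_iter P n k g x.
Proof.
move=> aP c0 cg; elim: k => [|k IH] x; first by rewrite expr0 mul1r.
rewrite exprS -mulrA; apply: (transfer_lb aP) => //.
by rewrite mulr_ge0// exprn_ge0// expR_ge0.
Qed.

(** As transfer_iterD_ind, with the first step split off: [fwd n k.+1] and [fwd
    (n + 1) k] are equal but not convertible. *)
Lemma transfer_iterS_ind P n k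
    (Phi : forall i, ((X n -> R) -> X i -> R) -> Prop) :
  Phi (fwd (n + 1) k)
    (fun u => transfer_iter P (n + 1) k (transfer P n u)) ->
  Phi (fwd n k.+1) (fun u => transfer_iter P n k.+1 u).
Proof. by move=> h; have := @transfer_iterD_ind P n 1 k Phi h; rewrite addn1. Qed.

Lemma transferZ P n (c : R) (u : X n -> R) : adm P ->
  transfer P n (fun x => c * u x) = (fun x => c * transfer P n u x).
Proof.
move=> aP; rewrite (_ : (fun x => _) = (fun x => c * u x + 0 * u x)).
  by rewrite (transfer_lin _ _ _ _ aP); apply/funext => x; rewrite mul0r addr0.
by apply/funext => x; rewrite mul0r addr0.
Qed.

(** Passage to the limit of approximations with an error proportional to a free
    [e > 0]. *)
Lemma le_of_approx (a b C : R) : 0 <= C ->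
  (forall e, 0 < e -> a <= b + C * e) -> a <= b.
Proof.
move=> C0 hab; apply/ler_addgt0Pr => e e0.
have C1 : 0 < C + 1 by rewrite ltr_wpDl.
apply: (le_trans (hab (e / (C + 1)) _)); first by rewrite divr_gt0.
rewrite lerD2l mulrA ler_pdivrMr// mulrC ler_pM2l//; lra.
Qed.

Lemma unif_distP (M : Type) (u v : M -> R) e :
  (unif_dist u v <= e%:E)%E <-> forall x, `|u x - v x| <= e.
Proof.
split=> [uve x|uve].
  by rewrite -lee_fin; apply: le_trans uve; apply: ereal_sup_ubound; exists x.
by apply: ge_ereal_sup => _ [x _ <-]; rewrite lee_fin.
Qed.

Section associated_data.
Variables (P : system X)
  (sigma : forall l : int, {finite_measure set (borel (X l)) -> \bar R})
  (f : forall l : int, X l -> R)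
  (lam : int -> R) (m : forall l : int, probability (borel (X l)) R)
  (h : forall l : int, X l -> R).
Arguments f : clear implicits.
Arguments h : clear implicits.
Hypotheses (aP : adm P) (asc : associated P sigma f lam m h delta beta Q).

Let sigma_fin l : (sigma l setT < +oo)%E.
Proof. by rewrite ltey_eq fin_num_measure. Qed.

Let m_fin l : (m l setT < +oo)%E. Proof. exact: probability_fin. Qed.

Lemma pairing_sigma_gt0 n k :
  0 < pairing (transfer_iter P n k (cst 1)) (sigma (fwd n k)).
Proof.
pose c : R := expR (- V) ^+ k.
have c0 : 0 < c by rewrite exprn_gt0 ?expR_gt0.
apply: (@lt_le_trans _ _ (pairing (cst c) (sigma (fwd n k)))).
  rewrite pairing_cst mulr_gt0// fine_gt0// sigma_fin andbT.
  exact: (assoc_sigma asc).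
apply: (pairing_le cX (sigma_fin _)).
- by move=> x; exact: cvg_cst.
- exact: (reg_cont (transfer_iter_regular _ aP (regular1 n))).
- move=> x; have := @transfer_iter_lb P n k (cst 1) 1 aP ler01 (fun=> lexx 1) x.
  by rewrite mulr1.
Qed.

(** [m] is an eigenvector of the dual operators: both quotients defining [m n]
    and [m (n + 1)] are governed by the same pairings [< L_n^(k+1) g, sigma >],
    up to the quotients defining [lam n]. *)
Lemma pairing_transfer n (g : X n -> R) : reg Q g ->
  pairing (transfer P n g) (m (n + 1)) = lam n * pairing g (m n).
Proof.
move=> gQ; have cg := reg_cont gQ.
have cLg := reg_cont (transfer_regQ aP gQ).
pose S (u : X n -> R) k :=
  pairing (transfer_iter P n k.+1 u) (sigma (fwd n k.+1)).
pose O k := pairing (transfer_iter P (n + 1) k (cst 1)) (sigma (fwd (n + 1) k)).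
have SE k : S g k = pairing (transfer_iter P (n + 1) k (transfer P n g))
    (sigma (fwd (n + 1) k)).
  exact: (@transfer_iterS_ind P n k
    (fun i A => pairing (A g) (sigma i) = _) erefl).
have h1 : (fun k => S g k / S (cst 1) k) @ \oo --> pairing g (m n).
  by have := assoc_m asc cg; rewrite -cvg_shiftS.
have h2 : (fun k => S (cst 1) k / O k) @ \oo --> lam n.
  exact: (assoc_lam asc).
have h3 : (fun k => S g k / O k) @ \oo --> pairing (transfer P n g) (m (n + 1)).
  rewrite (_ : (fun k => S g k / O k) = (fun k =>
    pairing (transfer_iter P (n + 1) k (transfer P n g))
      (sigma (fwd (n + 1) k)) / O k)); first exact: (assoc_m asc cLg).
  by apply/funext => k; rewrite SE.
have h4 : (fun k => S g k / O k) @ \oo --> lam n * pairing g (m n).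
  rewrite (_ : (fun k => _) =
      (fun k => S (cst 1) k / O k * (S g k / S (cst 1) k))).
    exact: (cvgM h2 h1).
  apply/funext => k; rewrite [RHS]mulrC mulrA divfK//.
  by rewrite gt_eqF//; exact: (pairing_sigma_gt0 n k.+1).
by rewrite -(cvg_lim (@Rhausdorff R) h3) (cvg_lim (@Rhausdorff R) h4).
Qed.

Lemma lamE n : lam n = pairing (transfer P n (cst 1)) (m (n + 1)).
Proof.
by rewrite (pairing_transfer (regular1 n)) pairing_probability_cst mulr1.
Qed.

Lemma lam_ge n : expR (- V) <= lam n.
Proof.
rewrite -(pairing_probability_cst (m (n + 1)) (expR (- V))) lamE.
apply: (pairing_le cX (m_fin _)).
- by move=> x; exact: cvg_cst.
- exact: (reg_cont (transfer_regQ aP (regular1 n))).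
- move=> x; have := @transfer_lb P n (cst 1) 1 aP ler01 (fun=> lexx 1) x.
  by rewrite mulr1.
Qed.

Lemma lam_gt0 n : 0 < lam n.
Proof. by apply: lt_le_trans (lam_ge n); exact: expR_gt0. Qed.

Lemma lam_le n : lam n <= D%:R * expR V.
Proof.
rewrite -(pairing_probability_cst (m (n + 1)) (D%:R * expR V)) lamE.
apply: (pairing_le cX (m_fin _)).
- exact: (reg_cont (transfer_regQ aP (regular1 n))).
- by move=> x; exact: cvg_cst.
- move=> x; have := transfer_ub (g := cst 1) aP ler01 (fun=> lexx 1) x.
  by rewrite mulr1.
Qed.

Definition lam_prod l k : R := \prod_(i < k) lam (l + i%:Z).

Lemma lam_prod_gt0 l k : 0 < lam_prod l k.
Proof. by apply: prodr_gt0 => i _; exact: lam_gt0. Qed.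

Lemma lam_prodS l k : lam_prod l k.+1 = lam_prod l k * lam (fwd l k).
Proof. by rewrite /lam_prod big_ord_recr/= fwdE. Qed.

Lemma pairing_transfer_iter n k (g : X n -> R) : reg Q g ->
  pairing (transfer_iter P n k g) (m (fwd n k)) = lam_prod n k * pairing g (m n).
Proof.
move=> gQ; elim: k => [|k IH]; first by rewrite /lam_prod big_ord0 mul1r.
have := pairing_transfer (transfer_iter_regular k aP gQ); rewrite -/(fwd n k.+1).
by rewrite lam_prodS IH => /= ->; ring.
Qed.

Lemma lam_prodE n k :
  lam_prod n k = pairing (transfer_iter P n k (cst 1)) (m (fwd n k)).
Proof.
by rewrite (pairing_transfer_iter _ (regular1 n)) pairing_probability_cst mulr1.
Qed.

Lemma pairing_gt0 n (g : X n -> R) z : reg Q g -> g z != 0 ->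
  0 < pairing g (m n).
Proof.
move=> gQ gz; have gz0 : 0 < g z by rewrite lt_neqAle eq_sym gz gQ.1.
rewrite -(pmulr_rgt0 _ (lam_prod_gt0 n tau.+1)) -pairing_transfer_iter//.
have F0 := floor_const_gt0.
apply: (@lt_le_trans _ _ (pairing
    (cst (g z / floor_const)) (m (fwd n tau.+1)))).
  by rewrite pairing_probability_cst divr_gt0.
apply: (pairing_le cX (m_fin _)).
- by move=> x; exact: cvg_cst.
- exact: (reg_cont (transfer_iter_regular _ aP gQ)).
- move=> x; rewrite ler_pdivrMr// mulrC.
  exact: (transfer_iter_floor z x aP gQ).
Qed.

(** The functions of the sequence defining [h n] are regular and normalised,
    and [L_n] maps the [k]-th of them to a multiple of the one of index [k + 1]
    in the sequence defining [h (n + 1)]. *)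
Lemma h_approx n (e : R) : 0 < e -> exists u : X n -> R,
  [/\ reg Q u, pairing u (m n) = 1, forall x, `|u x - h n x| <= e &
    forall x, `|(lam n)^-1 * transfer P n u x - h (n + 1) x| <= e].
Proof.
move=> e0.
have ev : \forall y \near 0%E, (y < e%:E)%E.
  by apply: open_nbhs_nbhs; split; [exact: open_ereal_lt_ereal|rewrite /= lte_fin].
have hlim j : h_limit P f lam m h j by exact: (assoc_h asc).
pose hseq l k : X (fwd l k) -> R := fun x =>
  transfer_iter P l k (f l) x / (lam_prod l k * pairing (f l) (m l)).
have ev1 : \forall k \near \oo,
    ((unif_dist (hseq (n - k%:Z) k) (h (fwd (n - k%:Z) k)))%R < e%:E)%E.
  exact: (hlim n _ ev).
have ev2 : \forall k \near \oo, 
    ((unif_dist (hseq (n + 1 - k.+1%:Z) k.+1)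
      (h (fwd (n + 1 - k.+1%:Z) k.+1)))%R < e%:E)%E.
  by have := hlim (n + 1); rewrite /h_limit -cvg_shiftS => /(_ _ ev).
have [k [{}ev1 {}ev2]] := filter_ex (filterI ev1 ev2).
have el : n + 1 - k.+1%:Z = n - k%:Z by rewrite -addn1 PoszD opprD addrACA subrr addr0.
move: ev2; rewrite el => ev2; set l := n - k%:Z in ev1 ev2.
have -> : n = fwd l k by rewrite fwdE subrK.
have fl : reg Q (f l) by apply: regular_cone; exact: (assoc_f asc).
have pf : 0 < pairing (f l) (m l).
  by have [_ _ [z fz] _] := assoc_f asc l; exact: pairing_gt0 fz.
pose c := lam_prod l k * pairing (f l) (m l).
have c0 : 0 < c by rewrite mulr_gt0// lam_prod_gt0.
have ufl := transfer_iter_regular k aP fl.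
exists (fun x => c^-1 * transfer_iter P l k (f l) x); split.
- by apply: regularZ => //; rewrite invr_ge0 ltW.
- rewrite (pairingZ cX _ (m_fin _) (reg_cont ufl)) pairing_transfer_iter//.
  by rewrite mulVf// gt_eqF.
- apply/unif_distP; have := ltW ev1; congr (_ <= _)%E; congr unif_dist.
  by apply/funext => x; rewrite mulrC.
- apply/unif_distP; have := ltW ev2; congr (_ <= _)%E; congr unif_dist.
  apply/funext => x; rewrite /hseq transferZ// lam_prodS /c /=.
  by field; rewrite !gt_eqF// ?lam_gt0 ?lam_prod_gt0.
Qed.

Lemma h_regular n : reg Q (h n).
Proof.
split=> [x|x x' xx'].
  apply: (@le_of_approx _ _ 1) => // e /(h_approx n)[u [[u0 _] _ hu _]].
  by have := hu x; rewrite ler_norml => /andP[]; have := u0 x; lra.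
set E := expR _; have E0 : 0 < E := expR_gt0 _.
apply: (@le_of_approx _ _ (E + 1)); first by rewrite addr_ge0// ltW.
move=> e /(h_approx n)[u [[_ uQ] _ hu _]].
have := uQ _ _ xx'; rewrite -/E; have := hu x; have := hu x'.
rewrite !ler_norml => /andP[_ h1] /andP[h2 _] h3.
have : E * u x' <= E * (h n x' + e) by rewrite ler_pM2l//; lra.
by rewrite mulrDr mulrDl; lra.
Qed.

Lemma h_pairing n : pairing (h n) (m n) = 1.
Proof.
have key e : 0 < e -> `|1 - pairing (h n) (m n)| <= e.
  move=> /(h_approx n)[u [uQ <- hu _]].
  exact: (pairing_near cX (m n) (reg_cont uQ) (reg_cont (h_regular n)) hu).
apply/eqP; rewrite eq_sym -subr_eq0 -normr_le0.
by apply: (@le_of_approx _ _ 1) => // e /key; rewrite add0r mul1r.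
Qed.

(** The approximations [u] of [h n] provided by h_approx have images close to
    [lam n * h (n + 1)], and the operator is Lipschitz for the uniform
    distance. *)
Lemma h_transfer n x : transfer P n (h n) x = lam n * h (n + 1) x.
Proof.
have l0 := lam_gt0 n; pose B := D%:R * expR V.
have B0 : 0 <= B by rewrite mulr_ge0// expR_ge0.
have T (u v : X n -> R) e : 0 < e -> (forall x, u x <= v x + e) ->
    transfer P n u x <= transfer P n v x + B * e.
  move=> e0 uv; have eE : (fun x => v x + e) = (fun x => 1 * v x + e * 1).
    by apply/funext => z; rewrite mul1r mulr1.
  apply: (le_trans (transfer_le aP uv x)).
  rewrite eE (transfer_lin 1 e v (cst 1) aP) mul1r lerD2l mulrC ler_wpM2r ?(ltW e0)//.
  by rewrite -[leRHS]mulr1; exact: (transfer_ub (g := cst 1) aP ler01 (fun=> lexx 1)).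
apply/eqP; rewrite -subr_eq0 -normr_le0.
apply: (@le_of_approx _ _ (B + lam n)); first by rewrite addr_ge0// ltW.
move=> e e0; have [u [_ _ hu hL]] := h_approx n e0.
have h1 : transfer P n u x <= transfer P n (h n) x + B * e.
  by apply: T => // z; have := hu z; rewrite ler_norml => /andP[]; lra.
have h2 : transfer P n (h n) x <= transfer P n u x + B * e.
  by apply: T => // z; have := hu z; rewrite ler_norml => /andP[]; lra.
have := hL x; rewrite -(ler_pM2l l0) -{1}(gtr0_norm l0) -normrM mulrBr mulVKf ?gt_eqF//.
by rewrite !ler_norml => /andP[h3 h4]; apply/andP; split; lra.
Qed.

Lemma h_transfer_iter l k x :
  transfer_iter P l k (h l) x = lam_prod l k * h (fwd l k) x.
Proof.
elim: k x => [|k IH] x; first by rewrite /lam_prod big_ord0 mul1r.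
have -> : transfer_iter P l k.+1 (h l) =
    transfer P (fwd l k) (fun z => lam_prod l k * h (fwd l k) z).
  by rewrite /=; congr transfer; apply/funext => z; rewrite IH.
by rewrite transferZ// h_transfer lam_prodS mulrA.
Qed.

Lemma h_neq0 n : exists x, h n x != 0.
Proof.
apply: contrapT => /forallNP h0; have := h_pairing n.
rewrite (_ : h n = cst 0); last first.
  by apply/funext => x; apply/eqP/negP => /negP/h0.
by rewrite pairing_probability_cst => /esym/eqP; rewrite oner_eq0.
Qed.

Lemma h_cone n : cone delta beta Q (h n).
Proof.
have [h0 hQ] := h_regular n; split => //; last exact: h_neq0.
exact: (reg_cont (h_regular n)).
Qed.

(** [h n] is proportional to the image of [h (n - tau - 1)], so its values are
    comparable to each other, hence to their average [1]. *)
Lemma h_le n x : h n x <= harnack_const.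
Proof.
suff key l y : h (fwd l tau.+1) y <= harnack_const.
  have := key (n - tau.+1%:Z); rewrite fwdE subrK; exact.
set A := harnack_const; have hQ := h_regular (fwd l tau.+1).
rewrite -[leLHS](pairing_probability_cst (m (fwd l tau.+1))).
rewrite -[leRHS]mulr1 -(h_pairing (fwd l tau.+1)).
rewrite -(pairingZ cX _ (m_fin _) (reg_cont hQ)).
apply: (pairing_le cX (m_fin _)).
- by move=> z; exact: cvg_cst.
- by apply: (reg_cont); apply: regularZ => //; apply: le_trans ler01 _;
    exact: harnack_const_ge1.
- move=> z; have := transfer_iter_harnack y z aP (h_regular l).
  rewrite !h_transfer_iter mulrCA ler_pM2l//; exact: lam_prod_gt0.
Qed.

End associated_data.

(** * Comparison of two sequences *)

Definition close (eta : R) (P P' : system X) n : Prop :=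
  (forall y, mdist (smap P n y) (smap P' n y) <= eta) /\
  (forall y, `|spot P n y - spot P' n y| <= eta).

Lemma close_sym eta (P P' : system X) n : close eta P P' n -> close eta P' P n.
Proof. by move=> [h1 h2]; split=> y; [rewrite metric_sym|rewrite distrC]. Qed.

(** Logarithm of a bound on the ratio of the images of a regular function under
    two operators at distance [eta]. *)
Definition step_error (eta : R) : R := eta + (H + Q) * eta `^ beta.

Lemma step_error_ge0 eta : 0 <= eta -> 0 <= step_error eta.
Proof.
move=> e0; rewrite addr_ge0// mulr_ge0 ?powR_ge0//.
by rewrite addr_ge0// ltW.
Qed.

Lemma transfer_iter_perturb P P' n k eta (g : X n -> R) :
  adm P -> adm P' -> reg Q g -> 0 <= eta -> 2 * eta <= delta ->
  (forall i, (i < k)%N -> close eta P P' (fwd n i)) ->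
  forall x, transfer_iter P n k g x <=
    expR (k%:R * step_error eta) * transfer_iter P' n k g x.
Proof.
move=> aP aP' gQ eta0 eta2; elim: k => [|k IH] hcl x.
  by rewrite mul0r expR0 mul1r.
have [hT hphi] := hcl k (leqnn _).
have uQ : reg Q (transfer_iter P n k g) := transfer_iter_regular k aP gQ.
have h1 := transfer_perturb rho01 beta01 H_gt0 aP aP' (ltW Q_gt0) uQ
  eta0 eta2 hT hphi x.
have {}IH : forall x, transfer_iter P n k g x <=
    expR (k%:R * step_error eta) * transfer_iter P' n k g x.
  by apply: IH => i ik; apply: hcl; exact: ltnW.
have h2 := transfer_le aP' IH x; rewrite transferZ// in h2.
rewrite -natr1 mulrDl mul1r addrC expRD -mulrA; apply: (le_trans h1).
by rewrite ler_wpM2l// expR_ge0.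
Qed.

Section family.
Variables (sigma : system X ->
    forall l : int, {finite_measure set (borel (X l)) -> \bar R})
  (f : system X -> forall l : int, X l -> R)
  (lam : system X -> int -> R)
  (m : system X -> forall l : int, probability (borel (X l)) R)
  (h : system X -> forall l : int, X l -> R).
Arguments f : clear implicits.
Arguments h : clear implicits.
Hypothesis asc : forall P : system X, adm P ->
  associated P (sigma P) (f P) (lam P) (m P) (h P) delta beta Q.

Let m_fin P l : (m P l setT < +oo)%E. Proof. exact: probability_fin. Qed.

(** Logarithm of a bound on the deviation from proportionality after [J.+1]
    blocks of [tau.+1] steps. *)
Definition memory_error J : R := gap_const ^- 2 * theta ^+ J.

Lemma memory_error_ge0 J : 0 <= memory_error J.
Proof.
have /andP[t0 _] := theta01; have /andP[g0 _] := gap_const01.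
by rewrite mulr_ge0// ?exprn_ge0 ?(ltW t0)// invr_ge0 exprn_ge0// ltW.
Qed.

Local Notation block J := (J.+1 * tau.+1)%N.

(** Both integrals are squeezed by the same multiple of [< L^k 1, m >], because
    [L^k g] is nearly proportional to [L^k 1] and the two sequences of
    operators differ by a factor [expR (k * step_error eta)]. *)
Lemma pairing_compare P P' n J eta (g : X n -> R) :
  adm P -> adm P' -> reg Q g -> 0 <= eta -> 2 * eta <= delta ->
  (forall i, (i < block J)%N -> close eta P P' (fwd n i)) ->
  pairing g (m P' n) <=
    expR (2 * ((block J)%:R * step_error eta) + memory_error J) *
      pairing g (m P n).
Proof.
move=> aP aP' gQ eta0 eta2 hcl.
have [[z gz]|/forallNP g0] := pselect (exists z, g z != 0); last first.
  rewrite (_ : g = cst 0) ?pairing_probability_cst ?mulr0//.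
  by apply/funext => x; apply/eqP/negP => /negP/g0.
set k := block J in hcl *; set K := k%:R * step_error eta.
have one0 : (cst 1 : X n -> R) point != 0 by rewrite oner_neq0.
have [a a0 ha] := transfer_iter_memory J aP gQ (regular1 n) gz one0.
rewrite -/k -/(memory_error J) in ha.
have L0 := lam_prod_gt0 aP (asc aP) n k; have L0' := lam_prod_gt0 aP' (asc aP') n k.
have cont Z (u : X n -> R) : adm Z -> reg Q u ->
    continuous (transfer_iter Z n k u).
  by move=> aZ uQ; exact: (reg_cont (transfer_iter_regular k aZ uQ)).
have h1 : a <= pairing g (m P n).
  rewrite -(ler_pM2l L0) -(pairing_transfer_iter aP (asc aP))//.
  rewrite mulrC (lam_prodE aP (asc aP)).
  have c1 := cont P (cst 1) aP (regular1 n).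
  rewrite -(pairingZ cX _ (m_fin _ _) c1).
  apply: (pairing_le cX (m_fin _ _)); last by move=> x; case/andP: (ha x).
  - by move=> x; apply: cvgM; [exact: cvg_cst|exact: c1].
  - exact: cont.
have hcl' i : (i < k)%N -> close eta P' P (fwd n i).
  by move=> ik; apply: close_sym; exact: hcl.
have h2 x : transfer_iter P' n k g x <=
    expR (2 * K + memory_error J) * a * transfer_iter P' n k (cst 1) x.
  apply: (le_trans (transfer_iter_perturb aP' aP gQ eta0 eta2 hcl' x)).
  have /andP[_ hax] := ha x.
  apply: (le_trans (ler_wpM2l (expR_ge0 _) hax)); rewrite -/K.
  have := transfer_iter_perturb aP aP' (regular1 n) eta0 eta2 hcl x; rewrite -/K.
  have c0 : 0 <= expR K * (expR (memory_error J) * a).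
    by rewrite !mulr_ge0 ?expR_ge0// ltW.
  move=> /(ler_wpM2l c0) hx; rewrite mulrA; apply: (le_trans hx).
  rewrite le_eqVlt; apply/orP; left; apply/eqP.
  by rewrite (_ : 2 * K + _ = K + K + memory_error J) ?expRD; ring.
have h3 : pairing g (m P' n) <= expR (2 * K + memory_error J) * a.
  rewrite -(ler_pM2l L0') -(pairing_transfer_iter aP' (asc aP'))//.
  rewrite mulrC (lam_prodE aP' (asc aP')).
  have c1 := cont P' (cst 1) aP' (regular1 n).
  rewrite -(pairingZ cX _ (m_fin _ _) c1).
  apply: (pairing_le cX (m_fin _ _)); last exact: h2.
  - exact: cont.
  - by move=> x; apply: cvgM; [exact: cvg_cst|exact: c1].
by apply: (le_trans h3); rewrite ler_wpM2l// expR_ge0.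
Qed.

(** The coefficients [5] and [3] cover the number of uses of each error in all
    of the comparisons below. *)
Definition total_error J eta : R :=
  5 * ((block J)%:R * step_error eta) + 3 * memory_error J.

Definition close_window eta P P' n k : Prop :=
  forall j : int, (`|j - n| <= k)%N -> close eta P P' j.

Lemma close_window_sym eta P P' n k :
  close_window eta P P' n k -> close_window eta P' P n k.
Proof. by move=> hcl j jn; apply: close_sym; exact: hcl. Qed.

Lemma le_total_error J eta (a b x : R) : 0 <= eta -> 0 <= x ->
  a <= 5 -> b <= 3 ->
  expR (a * ((block J)%:R * step_error eta) + b * memory_error J) * x <=
  expR (total_error J eta) * x.
Proof.
move=> e0 x0 a5 b3; rewrite ler_wpM2r// ler_expR lerD// ler_wpM2r//.
  by rewrite mulr_ge0// step_error_ge0.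
exact: memory_error_ge0.
Qed.

Lemma pairing_window P P' n J eta (g : X n -> R) :
  adm P -> adm P' -> reg Q g -> 0 <= eta -> 2 * eta <= delta ->
  close_window eta P P' n (block J) ->
  pairing g (m P' n) <= expR (total_error J eta) * pairing g (m P n).
Proof.
move=> aP aP' gQ e0 e2 hcl.
have hcl' i : (i < block J)%N -> close eta P P' (fwd n i).
  by move=> ik; apply: hcl; rewrite absz_fwd ltnW.
apply: (le_trans (pairing_compare aP aP' gQ e0 e2 hcl')).
rewrite -[memory_error J]mul1r; apply: le_total_error => //.
- by apply: Rintegral_ge0 => x _; exact: gQ.1.
- by rewrite ler_nat.
- by rewrite ler1n.
Qed.

(** [lam n] is the integral of [L_n 1] against [m (n + 1)], to which the
    comparison of integrals applies after one perturbation step. *)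
Lemma lam_window P P' n J eta :
  adm P -> adm P' -> 0 <= eta -> 2 * eta <= delta ->
  close_window eta P P' n (block J) ->
  lam P' n <= expR (total_error J eta) * lam P n.
Proof.
move=> aP aP' e0 e2 hcl.
have uQ : reg Q (transfer P n (cst 1)) := transfer_regQ aP (regular1 n).
have h1 : lam P' n <=
    expR (step_error eta) * pairing (transfer P n (cst 1)) (m P' (n + 1)).
  have c1 := reg_cont uQ.
  rewrite (lamE aP' (asc aP')) -(pairingZ cX _ (m_fin _ _) c1).
  apply: (pairing_le cX (m_fin _ _)).
  - exact: (reg_cont (transfer_regQ aP' (regular1 n))).
  - by move=> x; apply: cvgM; [exact: cvg_cst|exact: c1].
  - have hcl' i : (i < 1)%N -> close eta P' P (fwd n i).
      by case: i => // _; apply: close_sym; apply: hcl; rewrite subrr.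
    have := transfer_iter_perturb aP' aP (regular1 n) e0 e2 hcl'.
    by rewrite mul1r.
have hcl' i : (i < block J)%N -> close eta P P' (fwd (n + 1) i).
  by move=> ik; apply: hcl; rewrite fwdSl absz_fwd.
have := pairing_compare aP aP' uQ e0 e2 hcl'.
rewrite -(lamE aP (asc aP)) => /(ler_wpM2l (expR_ge0 (step_error eta))) h2.
apply: (le_trans h1); apply: (le_trans h2).
rewrite [leLHS]mulrA -expRD addrA; apply: (@le_trans _ _
  (expR (3 * ((block J)%:R * step_error eta) + 1 * memory_error J) * lam P n)).
  rewrite ler_wpM2r ?(ltW (lam_gt0 aP (asc aP) n))// ler_expR mul1r lerD2r.
  have : step_error eta <= (block J)%:R * step_error eta.
    by rewrite ler_peMl ?step_error_ge0// ler1n.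
  by lra.
by apply: le_total_error; rewrite ?(ltW (lam_gt0 aP (asc aP) n))// ?ler1n ?ler_nat.
Qed.

(** [h n] is nearly proportional to [L^k 1], started [k] steps earlier; the
    normalisation [< h n, m n > = 1] fixes the factor, and [m n] itself is
    controlled by the [k] steps that follow. *)
Lemma h_window P P' n J eta (x : X n) :
  adm P -> adm P' -> 0 <= eta -> 2 * eta <= delta ->
  close_window eta P P' n (block J) ->
  h P' n x <= expR (total_error J eta) * h P n x.
Proof.
move=> aP aP' e0 e2.
suff key l : close_window eta P P' (fwd l (block J)) (block J) ->
    forall y, h P' (fwd l (block J)) y <=
      expR (total_error J eta) * h P (fwd l (block J)) y.
  by move: x; have := key (n - (block J)%:Z); rewrite fwdE subrK => key' x /key'; exact.
move=> {x} hcl x.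
have hback i : (i < block J)%N -> close eta P' P (fwd l i).
  by move=> ik; apply: close_sym; apply: hcl; exact: absz_fwd_back (ltnW ik).
have hfwd i : (i < block J)%N -> close eta P' P (fwd (fwd l (block J)) i).
  by move=> ik; apply: close_sym; apply: hcl; rewrite absz_fwd ltnW.
set k := block J in hcl hback hfwd x *; set K := k%:R * step_error eta.
set c := memory_error J.
have prop Z : adm Z -> exists2 a : R, 0 < a & forall y,
    a * transfer_iter Z l k (cst 1) y <= h Z (fwd l k) y <=
    expR c * a * transfer_iter Z l k (cst 1) y.
  move=> aZ; have [z hz] := h_neq0 aZ (asc aZ) l.
  have one0 : (cst 1 : X l -> R) point != 0 by rewrite oner_neq0.
  have [a a0 ha] := transfer_iter_memory J aZ (h_regular aZ (asc aZ) l)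
    (regular1 l) hz one0.
  have L0 := lam_prod_gt0 aZ (asc aZ) l k.
  exists (a / lam_prod (lam Z) l k) => [|y]; first by rewrite divr_gt0.
  have := ha y; rewrite -/k (h_transfer_iter aZ (asc aZ)) => /andP[h1 h2].
  apply/andP; split.
    by rewrite mulrAC ler_pdivrMr// [leRHS]mulrC.
  by rewrite [X in _ <= X * _]mulrA [leRHS]mulrAC ler_pdivlMr// [leLHS]mulrC.
have [a a0 ha] := prop P aP; have [a' a'0 ha'] := prop P' aP'.
pose u := transfer_iter P l k (cst 1); pose u' := transfer_iter P' l k (cst 1).
have uQ : reg Q u := transfer_iter_regular k aP (regular1 l).
have u'Q : reg Q u' := transfer_iter_regular k aP' (regular1 l).
have cu := reg_cont uQ; have cu' := reg_cont u'Q.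
have scont b (w : X (fwd l k) -> R) : continuous w -> continuous (fun y => b * w y).
  by move=> cw y; apply: cvgM; [exact: cvg_cst|exact: cw].
set U' := pairing u' (m P' (fwd l k)).
have h1 : 1 <= expR (2 * c + 3 * K) * (a * U').
  rewrite -[leLHS](h_pairing aP (asc aP) (fwd l k)).
  apply: (@le_trans _ _ (expR c * a * pairing u (m P (fwd l k)))).
    rewrite -(pairingZ cX _ (m_fin _ _) cu).
    apply: (pairing_le cX (m_fin _ _)).
    - exact: (reg_cont (h_regular aP (asc aP) _)).
    - exact: scont.
    - by move=> y; case/andP: (ha y).
  have h2 := pairing_compare aP' aP uQ e0 e2 hfwd.
  have h3 : pairing u (m P' (fwd l k)) <= expR K * U'.
    rewrite -(pairingZ cX _ (m_fin _ _) cu').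
    apply: (pairing_le cX (m_fin _ _)) => //; first exact: scont.
    apply: transfer_iter_perturb => // [|i ik]; first exact: regular1.
    exact/close_sym/hback.
  have {}h3 := le_trans h2 (ler_wpM2l (expR_ge0 (2 * K + c)) h3).
  rewrite [leRHS]mulrA -expRD in h3.
  have ca0 : 0 <= expR c * a by rewrite mulr_ge0 ?expR_ge0// ltW.
  apply: (le_trans (ler_wpM2l ca0 h3)).
  rewrite le_eqVlt; apply/orP; left; apply/eqP.
  by rewrite (_ : 2 * c + 3 * K = c + (2 * K + c + K)) ?expRD; ring.
have h2 : a' * U' <= 1.
  rewrite -[leRHS](h_pairing aP' (asc aP') (fwd l k)).
  rewrite -(pairingZ cX _ (m_fin _ _) cu').
  apply: (pairing_le cX (m_fin _ _)); first exact: scont.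
  - exact: (reg_cont (h_regular aP' (asc aP') _)).
  - by move=> y; case/andP: (ha' y).
have h3 : h P' (fwd l k) x <= expR (c + K) * (a' * u x).
  have /andP[_ h3] := ha' x; apply: (le_trans h3).
  have := transfer_iter_perturb aP' aP (regular1 l) e0 e2 hback x; rewrite -/K.
  have ca0 : 0 <= expR c * a' by rewrite mulr_ge0 ?expR_ge0// ltW.
  move=> /(ler_wpM2l ca0) /le_trans; apply.
  by rewrite expRD le_eqVlt; apply/orP; left; apply/eqP; rewrite /u; ring.
have u0 : 0 <= u x := uQ.1 x.
have hx0 : 0 <= h P (fwd l k) x := (h_regular aP (asc aP) _).1 x.
set E := expR (2 * c + 3 * K) in h1.
have E0 : 0 <= E := expR_ge0 _.
have h4 : a' * u x <= E * h P (fwd l k) x.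
  have a'u0 : 0 <= a' * u x by rewrite mulr_ge0// ltW.
  have := ler_wpM2l a'u0 h1; rewrite mulr1 => /le_trans; apply.
  rewrite (_ : a' * u x * _ = E * (a' * U' * (a * u x))); last by ring.
  rewrite ler_wpM2l//; case/andP: (ha x) => hax _.
  apply: le_trans hax; rewrite ler_piMl// mulr_ge0//; exact: ltW.
apply: (le_trans h3).
apply: (@le_trans _ _ (expR (c + K) * (E * h P (fwd l k) x))).
  by rewrite ler_wpM2l// expR_ge0.
rewrite /E [leLHS]mulrA -expRD (_ : c + K + _ = 4 * K + 3 * c); last by ring.
by apply: le_total_error; rewrite // ler_nat.
Qed.

End family.

End dynamics.

(** * Hoelder bounds from geometric scales *)

Section scales.
Variable R : realType.

Lemma exists_expr_lt (z e : R) : 0 <= z < 1 -> 0 < e -> exists J, z ^+ J < e.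
Proof.
move=> /andP[z0 z1] e0.
have /cvg_expr /cvgrPdist_lt /(_ _ e0) /filter_ex[J] : `|z| < 1.
  by rewrite ger0_norm.
by rewrite sub0r normrN => /ltr_normlW; exists J.
Qed.

(** The difference is at most [expR s - 1 <= s * expR s] times the bound. *)
Lemma abs_ratio_le (x y s S B : R) : 0 <= s <= S -> 0 <= x <= B -> 0 <= y <= B ->
  x <= expR s * y -> y <= expR s * x -> `|x - y| <= s * (expR S * B).
Proof.
move=> /andP[s0 sS] /andP[x0 xB] /andP[y0 yB] xy yx.
have key u v : 0 <= v -> v <= B -> u <= expR s * v -> u - v <= s * (expR S * B).
  move=> v0 vB uv; have h1 : (expR s - 1) * v <= s * expR s * v.
    by rewrite ler_wpM2r// expR_sub1_le.
  have h2 : s * expR s * v <= s * (expR S * B).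
    by rewrite -mulrA ler_wpM2l// ler_pM ?expR_ge0// ler_expR.
  by lra.
by rewrite ler_norml; apply/andP; split;
  [have := key _ _ x0 xB yx; lra|exact: key].
Qed.

(** An error that is at most [C0 * om ^ J] as soon as [A * B ^ J * d <= 1] is
    at most a power of [d]: take the last admissible [J], for which [A * B ^ (J
    + 1) * d > 1], and the exponent [al] with [B ^ al = 1 / w] for some [w >=
    om]. *)
Lemma holder_of_scales (C0 om A B : R) :
  0 < om < 1 -> 1 <= A -> 1 < B -> 0 <= C0 ->
  exists al C : R, [/\ 0 < al <= 1, 0 < C & forall (e : \bar R) (d : R),
    0 <= d -> (e <= C0%:E)%E ->
    (forall J, A * B ^+ J * d <= 1 -> (e <= (C0 * om ^+ J)%:E)%E) ->
    (e <= (C * d `^ al)%:E)%E].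
Proof.
move=> /andP[om0 om1] A1 B1 C00.
have A0 : 0 < A by apply: lt_le_trans A1.
have B0 : 0 < B by apply: lt_trans B1.
(* The maximum with [B^-1] keeps the exponent [al] at most [1]. *)
pose w := Num.max om B^-1.
have w0 : 0 < w by rewrite lt_max om0.
have w1 : w < 1 by rewrite gt_max om1 invf_lt1.
have omw : om <= w by rewrite le_max lexx.
have Bw : B^-1 <= w by rewrite le_max lexx orbT.
have lnB : 0 < ln B by rewrite ln_gt0.
pose al := - ln w / ln B.
have al0 : 0 < al by rewrite divr_gt0// oppr_gt0 ln_lt0// w0.
have al1 : al <= 1.
  by rewrite ler_pdivrMr// mul1r lerNl -lnV ?posrE// ler_ln ?posrE ?invr_gt0.
have Bal J : (B ^+ J) `^ al = w ^- J.
  rewrite -{1}(lnK (x := B)) ?posrE// -expRM_natl -expRM.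
  rewrite -[in RHS](lnK (x := w)) ?posrE// -expRM_natl -expRN; congr expR.
  by rewrite /al; field; rewrite gt_eqF.
pose C := C0 * (A + w^-1 * A) + 1.
have wA : 0 <= w^-1 * A by rewrite mulr_ge0 ?invr_ge0// ltW.
have C1 : 0 < C by rewrite ltr_wpDl// mulr_ge0// addr_ge0// ltW.
exists al, C; split => //; first by rewrite al0.
move=> e d d0 eC0 eJ.
have Aal : A `^ al <= A by rewrite ler1_powR.
have powMA : (A * d) `^ al = A `^ al * d `^ al by rewrite powRM// ltW.
have dal : 0 <= d `^ al := powR_ge0 _ _.
have [Ad|Ad] := leP (A * d) 1; last first.
  apply: (le_trans eC0); rewrite lee_fin.
  have h1 : 1 <= A * d `^ al.
    apply: (@le_trans _ _ ((A * d) `^ al)); last by rewrite powMA ler_wpM2r.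
    rewrite -[leLHS](_ : 1 `^ al = 1); last by rewrite powR1.
    by apply: ge0_ler_powR; rewrite ?nnegrE ?(ltW al0) ?(ltW Ad)// (ltW (lt_trans ltr01 Ad)).
  have h2 : C0 * 1 <= C0 * (A * d `^ al) by rewrite ler_wpM2l.
  have h3 : 0 <= C0 * (w^-1 * A * d `^ al) by rewrite mulr_ge0// mulr_ge0.
  by rewrite /C; lra.
have [d_eq0|dn0] := eqVneq d 0.
  rewrite d_eq0 powR0 ?gt_eqF// mulr0; apply/lee_addgt0Pr => r r0.
  have [|J hJ] := @exists_expr_lt om (r / (C0 + 1)) _ (divr_gt0 r0 (ltr_wpDl C00 ltr01)).
    by rewrite om1 ltW.
  apply: (le_trans (eJ J _)); first by rewrite d_eq0 mulr0.
  rewrite add0e lee_fin; move: hJ; rewrite ltr_pdivlMr ?ltr_wpDl// => hJ.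
  have := exprn_ge0 J (ltW om0); move: hJ; rewrite mulrDr mulr1 mulrC; lra.
have d1 : 0 < d by rewrite lt_neqAle eq_sym dn0.
have Ad0 : 0 < A * d by rewrite mulr_gt0.
have exJ : exists J, 1 < A * B ^+ J * d.
  have [|J hJ] := @exists_expr_lt B^-1 (A * d) _ Ad0.
    by rewrite invr_ge0 (ltW B0) invf_lt1.
  exists J; move: hJ; rewrite exprVn -[X in X < _]div1r ltr_pdivrMr ?exprn_gt0//.
  by rewrite mulrAC.
case: (ex_minnP exJ) => -[|J]; first by rewrite expr0 mulr1 ltNge Ad.
move=> hJ minJ.
have {}minJ : A * B ^+ J * d <= 1.
  by rewrite leNgt; apply/negP => /minJ; rewrite ltnn.
apply: (le_trans (eJ J minJ)); rewrite lee_fin.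
have h1 : 1 <= w ^- J.+1 * (A * d `^ al).
  apply: (@le_trans _ _ ((A * B ^+ J.+1 * d) `^ al)).
    rewrite -[leLHS](_ : 1 `^ al = 1); last by rewrite powR1.
    apply: ge0_ler_powR; rewrite ?nnegrE ?(ltW al0) ?(ltW hJ)//.
    exact: (ltW (lt_trans ltr01 hJ)).
  rewrite mulrAC powRM ?exprn_ge0 ?(ltW Ad0) ?(ltW B0)// Bal powMA [leRHS]mulrC.
  by rewrite ler_wpM2r ?invr_ge0 ?exprn_ge0 ?(ltW w0)// ler_wpM2r.
have wJ : 0 < w ^+ J by rewrite exprn_gt0.
have h2 : w ^+ J <= w^-1 * (A * d `^ al).
  have := ler_wpM2l (ltW wJ) h1; rewrite mulr1 => /le_trans; apply.
  by rewrite mulrA exprS invfM [w ^+ J * (_ * _)]mulrCA divff ?mulr1// gt_eqF.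
have h3 : C0 * om ^+ J <= C0 * w ^+ J.
  by rewrite ler_wpM2l//; apply: lerXn2r; rewrite // nnegrE ltW.
have h4 := ler_wpM2l C00 h2.
have h5 : 0 <= C0 * (A * d `^ al) by rewrite mulr_ge0// mulr_ge0// ltW.
by rewrite /C; lra.
Qed.

End scales.

(** * Local Hoelder continuity *)

Section distance.
Variables (R : realType) (X : int -> pmetricType R).
Implicit Types P : system X.

Lemma ereal_sup_range_ge0 (T : pointedType) (u : T -> R) :
  (forall x, 0 <= u x) -> (0 <= ereal_sup (range (fun x => (u x)%:E)))%E.
Proof.
move=> u0; apply: (@le_trans _ _ (u point)%:E); first by rewrite lee_fin.
by apply: ereal_sup_ubound; exists point.
Qed.

Lemma sup_dist_ge0 P P' n : (0 <= sup_dist (smap P n) (smap P' n))%E.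
Proof.
apply: (@ereal_sup_range_ge0 (X n) (fun x => mdist (smap P n x) (smap P' n x))).
by move=> x; exact: mdist_ge0.
Qed.

Lemma spot_dist_ge0 P P' n : (0 <= unif_dist (spot P n) (spot P' n))%E.
Proof.
exact: (@ereal_sup_range_ge0 (X n) (fun x => `|spot P n x - spot P' n x|)).
Qed.

Lemma system_dist_ge0 P P' : (0 <= system_dist P P')%E.
Proof.
apply: esum_ge0 => n _; rewrite mule_ge0 ?lee_fin ?invr_ge0 ?exprn_ge0//.
by rewrite adde_ge0 ?sup_dist_ge0 ?spot_dist_ge0.
Qed.

Lemma system_dist_close P P' (d : R) j :
  (system_dist P P' <= d%:E)%E -> close (2 ^+ `|j|%N * d) P P' j.
Proof.
move=> hd; set s := (sup_dist (smap P j) (smap P' j) +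
  unif_dist (spot P j) (spot P' j))%E.
have hs : (s <= (2 ^+ `|j|%N * d)%:E)%E.
  have : ((2 ^- `|j|%N)%:E * s <= d%:E)%E.
    apply: le_trans hd; apply: esum_ge; exists [set j].
      by split=> //; exact: finite_set1.
    by rewrite fsbig_set1.
  by rewrite lee_pdivrMl ?exprn_gt0// EFinM.
split=> y; rewrite -lee_fin; apply: le_trans hs.
- apply: (@le_trans _ _ (sup_dist (smap P j) (smap P' j))).
    by apply: ereal_sup_ubound; exists y.
  by rewrite leeDl// spot_dist_ge0.
- apply: (@le_trans _ _ (unif_dist (spot P j) (spot P' j))).
    by apply: ereal_sup_ubound; exists y.
  by rewrite leeDr// sup_dist_ge0.
Qed.

Lemma close_le eta eta' P P' n : eta <= eta' -> close eta P P' n ->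
  close eta' P P' n.
Proof. by move=> h [h1 h2]; split=> y; [apply: le_trans (h1 y) h|apply: le_trans (h2 y) h]. Qed.

Lemma system_dist_window P P' (d : R) n k : 0 <= d ->
  (system_dist P P' <= d%:E)%E ->
  close_window (2 ^+ (`|n| + k)%N * d) P P' n k.
Proof.
move=> d0 hd j jn; apply: close_le (system_dist_close j hd).
rewrite ler_wpM2r// ler_eXn2l ?ltr1n//; clear -jn; lia.
Qed.

End distance.

Section error.
Variables (R : realType) (D tau : nat) (delta beta H V Q : R).
Variables (rate : R) (mult : nat).
Hypotheses (delta_gt0 : 0 < delta) (beta01 : 0 < beta < 1) (H_gt0 : 0 < H)
  (Q_gt0 : 0 < Q) (rate01 : 0 < rate < 1) (mult_large : 2 <= mult%:R * (1 - rate)).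

Let beta_gt0 : 0 < beta. Proof. by case/andP: beta01. Qed.
Let beta_lt1 : beta < 1. Proof. by case/andP: beta01. Qed.

Local Notation block J := (J.+1 * tau.+1)%N.
Local Notation err := (total_error D tau delta beta H V Q mult).

Lemma total_error_ge0 J eta : 0 <= eta -> 0 <= err J eta.
Proof.
move=> e0; rewrite addr_ge0// mulr_ge0//.
  by rewrite mulr_ge0//; apply: step_error_ge0.
exact: (memory_error_ge0 D tau delta beta V Q rate01 mult_large).
Qed.

(** With [t = 2 ^ k], [k = block J], the perturbation on the window of radius
    [k] is [eta = 2 ^ |n| * t * d]. If [2 ^ |n| * t ^ r.+1 * d <= 1], then [eta
    <= t ^- r], and [r * beta >= 2] makes [k * eta ^ beta <= t * t ^- 2 <= 2 ^-
    J]. *)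
Lemma total_error_scales (n : int) : exists A B C om : R,
  [/\ 1 <= A, 1 < B, 0 <= C, 0 < om < 1 & forall J d, 0 <= d ->
    A * B ^+ J * d <= 1 ->
    let eta := 2 ^+ (`|n| + block J)%N * d in
    2 * eta <= delta /\ err J eta <= C * om ^+ J].
Proof.
have [r hr] : exists r : nat, 2 <= r%:R * beta.
  exists (Num.bound (2 / beta)); rewrite -ler_pdivrMr//.
  by rewrite ltW// archi_boundP// divr_ge0// ltW.
have [g0 g1] := andP (gap_const01 D tau delta beta V Q rate01 mult_large).
have [t0 t1] := andP (theta01 D tau delta beta V Q rate01 mult_large).
set th := theta _ _ _ _ _ _ _ in t0 t1.
pose G := gap_const D tau delta beta V Q mult ^- 2.
have G0 : 0 <= G by rewrite invr_ge0 exprn_ge0// ltW.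
(* The factor [c1] ensures [eta <= 1] and [2 * eta <= delta]. *)
pose c1 := 1 + 2 / delta; have c11 : 1 <= c1 by rewrite lerDl divr_ge0// ltW.
have c10 : 0 < c1 by apply: lt_le_trans c11.
pose B : R := 2 ^+ (r.+1 * tau.+1)%N.
have B1 : 1 < B by rewrite exprn_egt1// ltr1n.
pose om := Num.max 2^-1 th.
have om0 : 0 < om by rewrite lt_max invr_gt0 ltr0n.
have om1 : om < 1 by rewrite gt_max t1 invf_lt1// ltr1n.
exists (2 ^+ `|n|%N * c1 * B), B, (5 * (1 + H + Q) + 3 * G), om; split=> //.
- by rewrite !mulr_ege1// ?exprn_ege1 ?ler1n// ltW.
- by rewrite addr_ge0// mulr_ge0// !addr_ge0// ltW.
- by rewrite om0.
move=> J d d0 hA eta.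
pose t : R := 2 ^+ block J.
have t_ge1 : 1 <= t by rewrite exprn_ege1// ler1n.
have t_gt0 : 0 < t by apply: lt_le_trans t_ge1.
have BJ : B * B ^+ J = t ^+ r.+1.
  by rewrite -exprS /B /t -!exprM; congr (_ ^+ _); rewrite -mulnA mulnC [(tau.+1 * _)%N]mulnC.
have etaE : eta = 2 ^+ `|n|%N * d * t by rewrite /eta exprD mulrAC.
set y := 2 ^+ `|n|%N * d in etaE; have y0 : 0 <= y by rewrite mulr_ge0// exprn_ge0.
have hy : c1 * (t ^+ r.+1 * y) <= 1.
  move: hA; rewrite -BJ /y; clearbody B c1.
  by move: (2 ^+ `|n|%N) (B ^+ J) => p b; congr (_ <= _); ring.
have ty0 : 0 <= t ^+ r.+1 * y by rewrite mulr_ge0// exprn_ge0// ltW.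
have eta0 : 0 <= eta by rewrite etaE mulr_ge0// ltW.
have eta_r : eta * t ^+ r = t ^+ r.+1 * y by rewrite etaE exprS; ring.
have tr1 : 1 <= t ^+ r by rewrite exprn_ege1.
have c1eta : c1 * eta <= 1.
  apply: le_trans hy; rewrite -eta_r ler_pM2l//.
  by rewrite ler_peMr.
have eta1 : eta <= 1 by apply: le_trans c1eta; rewrite ler_peMl.
have etar : eta * t ^+ r <= 1.
  by rewrite eta_r; apply: le_trans hy; rewrite ler_peMl.
split.
  have : delta * (c1 * eta) <= delta * 1 by rewrite ler_pM2l.
  have -> : delta * (c1 * eta) = delta * eta + 2 * eta.
    by rewrite /c1; field; rewrite gt_eqF.
  by have : 0 <= delta * eta by [rewrite mulr_ge0// ltW]; lra.
have etab : eta `^ beta <= t ^- 2.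
  have h1 : eta <= t ^- r by rewrite -[leRHS]div1r ler_pdivlMr// exprn_gt0.
  apply: (@le_trans _ _ ((t ^- r) `^ beta)).
    by apply: ge0_ler_powR; rewrite ?nnegrE ?invr_ge0 ?exprn_ge0 ?(ltW beta_gt0) ?(ltW t_gt0).
  rewrite -!powR_invn ?(ltW t_gt0)// -powRrM ler_powR// mulNr lerN2.
  exact: hr.
have eta_le : eta <= eta `^ beta.
  have [->|en0] := eqVneq eta 0; first exact: powR_ge0.
  by apply: ger1_powR (ltW beta_lt1); rewrite eta1 lt_neqAle eq_sym en0 eta0.
have step_le : step_error beta H Q eta <= (1 + H + Q) * t ^- 2.
  have := ler_wpM2l (addr_ge0 (ltW H_gt0) (ltW Q_gt0)) etab.
  by rewrite /step_error; move: eta_le etab; lra.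
have block_le : (block J)%:R <= t by rewrite /t -natrX ler_nat ltnW// ltn_expl.
have HQ0 : 0 <= 1 + H + Q by rewrite !addr_ge0// ltW.
have pow_le (z : R) : 0 <= z -> z <= om -> z ^+ J <= om ^+ J.
  by move=> z0 zom; apply: lerXn2r; rewrite // nnegrE ltW.
have t_inv : t^-1 <= om ^+ J.
  apply: (@le_trans _ _ (2^-1 ^+ J)); last first.
    by apply: pow_le; rewrite ?invr_ge0// le_max lexx.
  rewrite exprVn lef_pV2 ?posrE ?exprn_gt0//.
  rewrite ler_eXn2l ?ltr1n//; apply: leq_trans (leqnSn J) _.
  by rewrite -[X in (X <= _)%N]muln1 leq_mul.
have kstep : (block J)%:R * step_error beta H Q eta <= (1 + H + Q) * om ^+ J.
  apply: (@le_trans _ _ (t * ((1 + H + Q) * t ^- 2))).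
    by apply: ler_pM => //; apply: step_error_ge0.
  have -> : t * ((1 + H + Q) * t ^- 2) = (1 + H + Q) * t^-1.
    by field; rewrite gt_eqF.
  by rewrite ler_wpM2l.
have mem : memory_error D tau delta beta V Q mult J <= G * om ^+ J.
  rewrite ler_wpM2l//; apply: pow_le; first exact: ltW.
  by rewrite le_max lexx orbT.
by rewrite /total_error; move: kstep mem; lra.
Qed.

End error.

(** The estimate holds on balls of any radius: the error is bounded where the
    distance is not small, and the right-hand side is infinite where the
    distance is. *)
Lemma locally_holder_of_window (R : realType) (X : int -> pmetricType R)
    (D tau : nat) (delta beta H V Q rate : R) (mult : nat)
    (delta_gt0 : 0 < delta) (beta01 : 0 < beta < 1) (H_gt0 : 0 < H)
    (Q_gt0 : 0 < Q) (rate01 : 0 < rate < 1)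
    (mult_large : 2 <= mult%:R * (1 - rate))
    (W : Type) (dW : W -> W -> \bar R) (F : system X -> W)
    (S : set (system X)) (n : int) (B : R) : 0 <= B ->
  (forall P P', S P -> S P' -> (dW (F P) (F P') <= B%:E)%E) ->
  (forall P P' J eta E, S P -> S P' -> 0 <= eta -> 2 * eta <= delta ->
    close_window eta P P' n (J.+1 * tau.+1) ->
    0 <= total_error D tau delta beta H V Q mult J eta <= E ->
    (dW (F P) (F P') <=
      (total_error D tau delta beta H V Q mult J eta * (expR E * B))%:E)%E) ->
  locally_holder S (@system_dist R X) dW F.
Proof.
move=> B0 hB hJ P0 _.
have [A [b [C [om [A1 b1 C0 om01 herr]]]]] := total_error_scales D tau V
  delta_gt0 beta01 H_gt0 Q_gt0 rate01 mult_large n.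
pose K := B + C * (expR C * B).
have CB0 : 0 <= C * (expR C * B) by rewrite mulr_ge0// mulr_ge0// expR_ge0.
have K0 : 0 <= K by rewrite addr_ge0.
have [al [Ct [al01 Ct0 hal]]] := holder_of_scales om01 A1 b1 K0.
exists 1, al, Ct; split=> //; first exact: ltW.
move=> P P' SP SP' _ _.
have := system_dist_ge0 P P'; case hd : (system_dist P P') => [d| |] //.
  rewrite lee_fin => d0; rewrite poweR_EFin -EFinM; apply: hal => //.
    by apply: (le_trans (hB _ _ SP SP')); rewrite lee_fin lerDl.
  move=> J hAJ; have [e2 ee] := herr J d d0 hAJ.
  set eta := 2 ^+ _ * d in e2 ee.
  have eta0 : 0 <= eta by rewrite mulr_ge0// exprn_ge0.
  have err0 : 0 <= total_error D tau delta beta H V Q mult J eta.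
    exact: (total_error_ge0 D tau delta beta V H_gt0 Q_gt0 rate01 mult_large).
  have hcl : close_window eta P P' n (J.+1 * tau.+1).
    by apply: system_dist_window; rewrite // hd.
  have [om0 om1] := andP om01.
  have omJ : 0 <= om ^+ J <= 1 by rewrite exprn_ge0 ?exprn_ile1 ?(ltW om0) ?(ltW om1).
  have [omJ0 omJ1] := andP omJ.
  have errC : total_error D tau delta beta H V Q mult J eta <= C.
    by apply: (le_trans ee); rewrite ler_piMr.
  apply: (le_trans (hJ _ _ _ _ C SP SP' eta0 e2 hcl _)); first by rewrite err0.
  rewrite lee_fin; apply: (@le_trans _ _ (C * om ^+ J * (expR C * B))).
    by rewrite ler_wpM2r// mulr_ge0// expR_ge0.
  by rewrite mulrAC ler_wpM2r// lerDr.
move=> _; have [al0 _] := andP al01.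
by rewrite poweRyr ?gt_eqF// gt0_muley ?lte_fin// leey.
Qed.

Theorem mainTheorem4 (R : realType) (D tau : nat) (delta rho beta H V : R)
    (delta_gt0 : 0 < delta) (rho01 : 0 < rho < 1) (beta01 : 0 < beta < 1)
    (H_gt0 : 0 < H) (V_gt0 : 0 < V) :
  exists Q0 : R, forall Q : R, Q0 <= Q ->
  forall X : int -> pmetricType R,
  (forall n : int, compact [set: X n]) ->
  let F := [set P : system X | admissible D tau delta rho beta H V P] in
  forall (sigma : system X ->
            forall l : int, {finite_measure set (borel (X l)) -> \bar R})
         (f : system X -> forall l : int, X l -> R)
         (lam : system X -> int -> R)
         (m : system X -> forall l : int, probability (borel (X l)) R)
         (h : system X -> forall l : int, X l -> R),
  (forall P : system X, F P ->
     associated P (sigma P) (f P) (lam P) (m P) (h P) delta beta Q) ->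
  forall n : int,
  [/\ locally_holder F (@system_dist R X) (@real_dist R) (fun P => lam P n),
      (forall g : X n -> R, cone delta beta Q g ->
         locally_holder F (@system_dist R X) (@real_dist R)
           (fun P => pairing g (m P n))),
      (forall P : system X, F P -> cone delta beta Q (h P n)) &
      locally_holder F (@system_dist R X) (@unif_dist R (X n))
        (fun P => h P n)].
Proof.
have [rho0 rho1] := andP rho01; have [beta0 beta1] := andP beta01.
have rb0 : 0 < rho `^ beta by exact: powR_gt0.
have rb1 : rho `^ beta < 1.
  have e1 : 1 `^ beta = 1 :> R by rewrite powR1.
  by rewrite -[ltRHS]e1; apply: gt0_ltr_powR; rewrite ?nnegrE ?(ltW rho0).
pose G := gain D delta beta H.
have G0 : 0 < G by rewrite ltr_wpDr// mulr_ge0// powR_ge0.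
(* Halfway between [rho ^ beta] and [1]; for [Q] beyond the bound below, one step
   maps the cone of exponent [Q] into that of exponent [rate * Q]. *)
pose rate := (1 + rho `^ beta) / 2.
have rate01 : 0 < rate < 1 by rewrite /rate; apply/andP; split; lra.
have onem_rb : 0 < 1 - rho `^ beta by rewrite subr_gt0.
exists (2 * G / (1 - rho `^ beta)) => Q Q0 X cX F sigma f lam m h asc n.
have Q_gt0 : 0 < Q by apply: lt_le_trans Q0; rewrite divr_gt0// mulr_gt0.
have Q_large : rho `^ beta * Q + gain D delta beta H <= rate * Q.
  by move: Q0; rewrite ler_pdivrMr// -/G /rate; lra.
have [mult mult_large] : exists mult : nat, 2 <= mult%:R * (1 - rate).
  have [_ r1] := andP rate01.
  exists (Num.bound (2 / (1 - rate))); rewrite -ler_pdivrMr ?subr_gt0//.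
  by rewrite ltW// archi_boundP// divr_ge0// subr_ge0 ltW.
have holder W (dW : W -> W -> \bar R) Fn := @locally_holder_of_window R X D tau
  delta beta H V Q rate mult delta_gt0 beta01 H_gt0 Q_gt0 rate01 mult_large
  W dW Fn F n.
have lamb P (FP : F P) : 0 <= lam P n <= D%:R * expR V.
  rewrite (lam_le delta_gt0 rho01 beta01 H_gt0 Q_gt0 rate01 Q_large cX FP (asc P FP)).
  by rewrite (ltW (lam_gt0 delta_gt0 rho01 beta01 H_gt0 Q_gt0 rate01 Q_large cX FP (asc P FP) n)).
have dist_le (x y B : R) : 0 <= x <= B -> 0 <= y <= B -> `|x - y| <= B.
  by move=> /andP[? ?] /andP[? ?]; rewrite ler_norml; apply/andP; split; lra.
split.
- apply: (holder _ _ _ (D%:R * expR V)).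
  + by rewrite mulr_ge0// expR_ge0.
  + by move=> P P' FP FP'; rewrite lee_fin dist_le ?lamb.
  + move=> P P' J eta E FP FP' e0 e2 hcl hE; rewrite lee_fin.
    have w := lam_window delta_gt0 rho01 beta01 H_gt0 Q_gt0 rate01 Q_large
      mult_large cX asc.
    apply: abs_ratio_le hE (lamb _ FP) (lamb _ FP') _ _.
      exact: (w _ _ _ _ _ FP' FP e0 e2 (close_window_sym hcl)).
    exact: (w _ _ _ _ _ FP FP' e0 e2 hcl).
- move=> g gC; have [cg g0 _ _] := gC; have gQ := regular_cone gC.
  have [B gB] : exists B, forall x, g x <= B.
    have /compact_bounded[M [_ hM]] : compact (g @` [set: X n]).
      by apply: continuous_compact => //; exact: continuous_subspaceT.
    exists (M + 1) => x; apply: le_trans (ler_norm _) _.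
    by apply: (hM (M + 1)); [rewrite ltrDl|exists x].
  have B0 : 0 <= B := le_trans (g0 point) (gB point).
  have gb P : 0 <= pairing g (m P n) <= B.
    apply/andP; split; first by apply: Rintegral_ge0.
    rewrite -[leRHS](pairing_probability_cst (m P n)).
    apply: (pairing_le cX (probability_fin _)) => // x; exact: cvg_cst.
  apply: (holder _ _ _ B) => // [P P' _ _|]; first by rewrite lee_fin dist_le.
  move=> P P' J eta E FP FP' e0 e2 hcl hE; rewrite lee_fin.
  have w := pairing_window delta_gt0 rho01 beta01 H_gt0 Q_gt0 rate01 Q_large
    mult_large cX asc.
  apply: abs_ratio_le hE (gb _) (gb _) _ _.
    exact: (w _ _ _ _ _ _ FP' FP gQ e0 e2 (close_window_sym hcl)).
  exact: (w _ _ _ _ _ _ FP FP' gQ e0 e2 hcl).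
- move=> P FP.
  exact: (h_cone delta_gt0 rho01 beta01 H_gt0 Q_gt0 rate01 Q_large cX FP (asc P FP)).
- pose M := harnack_const D tau delta beta V Q.
  have hb P (FP : F P) x : 0 <= h P n x <= M.
    rewrite (h_le delta_gt0 rho01 beta01 H_gt0 Q_gt0 rate01 Q_large cX FP (asc P FP)).
    have [_ -> _ _] := h_cone delta_gt0 rho01 beta01 H_gt0 Q_gt0 rate01 Q_large
      cX FP (asc P FP) n.
    by [].
  apply: (holder _ _ _ M).
  + exact: (le_trans ler01 (harnack_const_ge1 D tau delta beta V Q)).
  + by move=> P P' FP FP'; apply/unif_distP => x; rewrite dist_le ?hb.
  + move=> P P' J eta E FP FP' e0 e2 hcl hE; apply/unif_distP => x.
    have w := h_window delta_gt0 rho01 beta01 H_gt0 Q_gt0 rate01 Q_large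
      mult_large cX asc.
    apply: abs_ratio_le hE (hb _ FP x) (hb _ FP' x) _ _.
      exact: (w _ _ _ _ _ x FP' FP e0 e2 (close_window_sym hcl)).
    exact: (w _ _ _ _ _ x FP FP' e0 e2 hcl).
Qed.
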